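(* Assume that both $n_1$ and $n_2$ are divisible by $n$, where $n_1+n_2=n'$, and let $B_1:=n_1/n$, $B_2:=n_2/n$, $B:=n'/n$. Let $\mu$ and $\nu$ be the column vectors obtained by vectorizing $C$ and $V$ respectively; similarly let $\hat\mu_a$ and $\hat\nu_b$ be the vectorizations of $\widehat C_a$ and $\widehat C_b^{-1}$, and let $\hat\mu$ and $\hat\nu$ be i.i.d. copies of $\hat\mu_a$ and $\hat\nu_b$. Then $$\mathrm{bias}(\widehat H_1)=0,\qquad \mathrm{bias}(\widehat H_2)=\mathrm{bias}(\widehat H_3)=\frac{d-\operatorname{Tr}(CV)}{B},$$ $$\mathrm{Var}(\operatorname{Tr}(\widehat H_1))=\frac{\operatorname{Tr}\left(\mathrm{Var}(\hat\mu)\mathrm{Var}(\hat\nu)\right)}{B_1B_2}+\frac{\operatorname{Tr}\left(\mathrm{Var}(\hat\nu)\mu\mu^T\right)}{B_2}+\frac{\operatorname{Tr}\left(\mathrm{Var}(\hat\mu)\nu\nu^T\right)}{B_1}.$$ Furthermore, if $B$ is fixed (equivalently, $n$ and $n'$ are fixed), then the variance of $\operatorname{Tr}(\widehat H_1)$, as a function of the integer $B_1$ (with $B_2=B-B_1$), is minimized by the ceiling or the floor of $$B_1^*=\begin{cases}\left(\dfrac{a_1-\sqrt{a_1a_2}}{a_1-a_2}\right)B & \text{if } a_1\neq a_2,\\[2mm] B/2 & \text{otherwise},\end{cases}$$ where $$a_1:=\frac{\operatorname{Tr}(\mathrm{Var}(\hat\mu)\mathrm{Var}(\hat\nu))}{B}+\operatorname{Tr}(\mathrm{Var}(\hat\mu)\nu\nu^T),\qquad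 a_2:=\frac{\operatorname{Tr}(\mathrm{Var}(\hat\mu)\mathrm{Var}(\hat\nu))}{B}+\operatorname{Tr}(\mathrm{Var}(\hat\nu)\mu\mu^T).$$
   Context: Let $\phi(x)=(\phi_1(x),\dots,\phi_d(x))^T$ be a vector of real-valued functions on $\mathcal X\subset\mathbb R^M$, and let $p(x)$ be a density on $\mathcal X$. Let $D_0=\{x_1,\dots,x_n\}$ be an i.i.d. sample from $p$ and $\widehat C=\frac1n\sum_{i=1}^n\phi(x_i)\phi(x_i)^T$. Put $C=E_x[\phi(x)\phi(x)^T]$ and $V=E[\widehat C^{-1}]$ (both $d\times d$ matrices). Unlabeled data $D_U=\{x'_1,\dots,x'_{n'}\}$ are i.i.d. from $p$. They are divided into $D_U^1=\{x'_1,\dots,x'_{n_1}\}$ and $D_U^2=\{x'_{n_1+1},\dots,x'_{n_1+n_2}\}$, with $n_1+n_2=n'$. When $n$ divides $n_1$ and $n_2$, $D_U$ is partitioned into $B=n'/n$ consecutive blocks $D_1,\dots,D_B$ of $n$ samples each, so that $D_U^1=\bigcup_{a=1}^{B_1}D_a$ and $D_U^2=\bigcup_{b=B_1+1}^{B}D_b$; each block is an i.i.d. copy of $D_0$. Let $\widehat C_b=\frac1n\sum_{x'\in D_b}\phi(x')\phi(x')^T$. The estimators of $CV$ are $$\widehat H_1=\Big(\frac1{B_1}\sum_{a=1}^{B_1}\widehat C_a\Big)\Big(\frac1{B_2}\sum_{b=B_1+1}^{B}\widehat C_b^{-1}\Big),\quad \widehat H_2=\Big(\frac1{B_1}\sum_{a=1}^{B_1}\widehat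 C_a\Big)\Big(\frac1{B}\sum_{b=1}^{B}\widehat C_b^{-1}\Big),\quad \widehat H_3=\Big(\frac1{B}\sum_{a=1}^{B}\widehat C_a\Big)\Big(\frac1{B}\sum_{b=1}^{B}\widehat C_b^{-1}\Big).$$ That is, $C$ is estimated from $D_U^1$, $D_U^1$, $D_U$ and $V$ from $D_U^2$, $D_U$, $D_U$, respectively. Notation: $\mathrm{bias}(\widehat H):=E[\operatorname{Tr}(\widehat H)-\operatorname{Tr}(CV)]$. For a random scalar, $\mathrm{Var}$ is the variance; for a random vector, $\mathrm{Var}$ is the covariance matrix (so $\mathrm{Var}(\hat\mu)$ and $\mathrm{Var}(\hat\nu)$ are $d^2\times d^2$ matrices). Implicit standing assumptions: the matrices $\widehat C_b$ are invertible almost surely and all moments appearing exist and are finite. *)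

(* Defs.v *)
From HB Require Import structures.
From mathcomp Require Import all_boot all_order all_algebra.
From mathcomp Require Import all_classical all_reals all_analysis.

Set Implicit Arguments.
Unset Strict Implicit.
Unset Printing Implicit Defensive.

Import Order.TTheory GRing.Theory Num.Theory.
Import numFieldNormedType.Exports.

Local Open Scope classical_set_scope.
Local Open Scope ring_scope.

Section LebesgueTuple.
Context {R : realType}.

Definition tcons M (tx : M.-tuple R * R) : M.+1.-tuple R :=
  [the M.+1.-tuple R of tx.2 :: tx.1].

Lemma measurable_tcons M : measurable_fun [set: M.-tuple R * R] (@tcons M).
Proof. exact: (measurable_cons measurable_snd measurable_fst). Qed.

Definition lebesgue_cons M (m : {measure set (M.-tuple R) -> \bar R}) :
    {measure set (M.+1.-tuple R) -> \bar R} :=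
  measure_function_pushforward__canonical__measure_function_Measure
    (m \x @lebesgue_measure R)%E (@measurable_tcons M).

(* Lebesgue measure on R^M, as an iterated product of the one-dimensional one
   (Dirac mass at the empty tuple for M = 0) *)
Fixpoint lebesgue_tuple M : {measure set (M.-tuple R) -> \bar R} :=
  match M with
  | 0 => \d_([tuple] : 0.-tuple R)
  | M'.+1 => lebesgue_cons (lebesgue_tuple M')
  end.

Lemma lebesgue_tuple_box M (A : 'I_M -> set R) :
  (forall i, measurable (A i)) ->
  lebesgue_tuple M [set t | forall i, A i (tnth t i)] =
  (\prod_(i < M) (@lebesgue_measure R) (A i))%E.
Proof.
elim: M A => [|M IH] A mA /=.
  rewrite big_ord0 diracE mem_set//= => -[]//.
rewrite /pushforward /=.
have -> : (@tcons M) @^-1` [set t | forall i, A i (tnth t i)] =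
   [set t | forall i, A (lift ord0 i) (tnth t i)] `*` A ord0.
  apply/seteqP; split => [[t x] /= h|[t x] /= [h h0] i].
    split=> [i|]; last exact: (h ord0).
    by have := h (lift ord0 i); rewrite tnthS.
  case: (unliftP ord0 i) => [j ->|->]; last exact: h0.
  by rewrite tnthS; exact: h.
have mB : measurable [set t : M.-tuple R | forall i, A (lift ord0 i) (tnth t i)].
  have -> : [set t : M.-tuple R | forall i, A (lift ord0 i) (tnth t i)] =
      \bigcap_(i in [set: 'I_M])
        (fun t : M.-tuple R => tnth t i) @^-1` A (lift ord0 i).
    by apply/seteqP; split => t /= h i; [move=> _; exact: h | exact: h].
  apply: fin_bigcap_measurable => // i _.
  by rewrite -[X in measurable X]setTI; exact: measurable_tnth.
rewrite product_measure1E//; last exact: mA.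
rewrite (IH (fun i => A (lift ord0 i))); last by move=> i; exact: mA.
by rewrite big_ord_recl muleC.
Qed.

End LebesgueTuple.
Arguments lebesgue_tuple : clear implicits.

Section Sampling.
Context {R : realType} {M : nat}.

Definition is_density (X : set (M.-tuple R)) (p : M.-tuple R -> R) : Prop :=
  [/\ measurable_fun X p, forall x, X x -> 0 <= p x &
      (\int[lebesgue_tuple R M]_(x in X) (p x)%:E = 1)%E].

Context {dO : measure_display} {Omega : measurableType dO}.
Variable P : probability Omega R.

Definition mutually_independent (I : finType) (x : I -> Omega -> M.-tuple R) :
    Prop :=
  forall (J : {set I}) (A : I -> set (M.-tuple R)),
    (forall i, measurable (A i)) ->
    P (\bigcap_(i in [set` J]) (x i @^-1` A i)) =
    (\prod_(i in J) P (x i @^-1` A i))%E.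

Definition iid_sample (X : set (M.-tuple R)) (p : M.-tuple R -> R)
    (I : finType) (x : I -> {RV P >-> M.-tuple R}) : Prop :=
  [/\ forall i w, X (x i w),
      forall i (A : set (M.-tuple R)), measurable A ->
        P (x i @^-1` A) =
        (\int[lebesgue_tuple R M]_(t in A `&` X) (p t)%:E)%E &
      mutually_independent (fun i => x i : Omega -> M.-tuple R)].

End Sampling.

Section RandomMatrices.
Context {R : realType} {dO : measure_display} {Omega : measurableType dO}.
Variable P : probability Omega R.

Definition Emx m k (A : Omega -> 'M[R]_(m, k)) : 'M[R]_(m, k) :=
  \matrix_(i, j) fine 'E_P[fun w => A w i j].

Definition Covmx k (Y : Omega -> 'cV[R]_k) : 'M[R]_k :=
  \matrix_(i, j) fine (covariance P (fun w => Y w i 0) (fun w => Y w j 0)).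

(* equality of the laws on R^k, vectors being read as k-tuples to use the
   product Borel sigma-algebra *)
Definition same_law k (Y Z : Omega -> 'cV[R]_k) : Prop :=
  forall A : set (k.-tuple R), measurable A ->
    P [set w | A [tuple Y w i 0 | i < k]] =
    P [set w | A [tuple Z w i 0 | i < k]].

Definition square_integrable k (Y : Omega -> 'cV[R]_k) : Prop :=
  forall i, (fun w => Y w i 0) \in Lfun P 2%:E.

Definition bias d (H : Omega -> 'M[R]_d) (K : 'M[R]_d) : \bar R :=
  'E_P[fun w => \tr (H w) - \tr K].

End RandomMatrices.

Section Estimators.
Context {R : realType}.

(* [mxvec] is row-major; transposing first stacks the columns of A *)
Definition vec m k (A : 'M[R]_(m, k)) : 'cV[R]_(k * m) := (mxvec A^T)^T.

Section SecondMoment.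
Context {M d : nat}.
Variable phi : 'I_d -> M.-tuple R -> R.

Definition feature (x : M.-tuple R) : 'cV[R]_d := \col_i phi i x.

Definition pop_moment (X : set (M.-tuple R)) (p : M.-tuple R -> R) : 'M[R]_d :=
  \matrix_(i, j) \int[lebesgue_tuple R M]_(x in X)
    ((feature x *m (feature x)^T) i j * p x).

(* the divisor is the nominal sample size n, which is the size of D below *)
Definition emp_moment (n N : nat) (x : 'I_N -> M.-tuple R) (D : pred 'I_N) :
    'M[R]_d :=
  n%:R^-1 *: \sum_(i < N | D i) (feature (x i) *m (feature (x i))^T).

(* consecutive blocks of n samples, numbered from 0 *)
Definition block (n N b : nat) : pred 'I_N := fun i => (i %/ n == b)%N.

Definition block_moment (n N : nat) (x : 'I_N -> M.-tuple R) (b : nat) :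
    'M[R]_d :=
  emp_moment n x (block n b).

End SecondMoment.

Section Hhat.
Context {d : nat}.
Variable Cb : nat -> 'M[R]_d.

(* averages over the blocks b0, ..., b1 - 1 *)
Definition mean_C (b0 b1 : nat) : 'M[R]_d :=
  (b1 - b0)%:R^-1 *: \sum_(b0 <= a < b1) Cb a.

Definition mean_invC (b0 b1 : nat) : 'M[R]_d :=
  (b1 - b0)%:R^-1 *: \sum_(b0 <= b < b1) invmx (Cb b).

(* B1 blocks out of B form the first part of the data, B - B1 the second *)
Definition Hhat1 (B1 B : nat) : 'M[R]_d := mean_C 0 B1 *m mean_invC B1 B.
Definition Hhat2 (B1 B : nat) : 'M[R]_d := mean_C 0 B1 *m mean_invC 0 B.
Definition Hhat3 (B : nat) : 'M[R]_d := mean_C 0 B *m mean_invC 0 B.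

End Hhat.

End Estimators.
Arguments block {n N} b _ : rename.

(* Main.v *)
(* Tr(H1) is a sum over s of m_s * v_s, where m_s and v_s average coordinates of
   the vectorized block matrices and of their inverses over disjoint sets of
   blocks; m and v are independent, so the first two moments of Tr(H1) factor.
   For H2 and H3 the only dependent pairs of blocks are the coincident ones,
   where Tr(C_b C_b^-1) = d.

   As a function of k = B1 the variance is a1 / k + a2 / (B - k), which decreases
   up to its critical point and increases after it.  This point lies strictly
   between 0 and B unless exactly one of a1 and a2 vanishes, which would force
   Tr(Var(muh) Var(nuh)) = 0.  In that case the centered vectors y and z of C_b
   and of C_b^-1 are a.s. orthogonal: y is a.s. in the kernel of Var(nuh), to
   which z is a.s. orthogonal.  Expanding y . z = 0 with Tr(C_b C_b^-1) = d gives
   nu . y = - mu . z, hence a1 = a2. *)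

Require Import Defs.
From HB Require Import structures.
From mathcomp Require Import all_boot all_order all_algebra.
From mathcomp Require Import all_classical all_reals all_analysis.
From mathcomp Require Import measurable_realfun ring lra zify.

Set Implicit Arguments.
Unset Strict Implicit.
Unset Printing Implicit Defensive.

Import Order.TTheory GRing.Theory Num.Theory.
Import numFieldNormedType.Exports.

Local Open Scope classical_set_scope.
Local Open Scope ring_scope.

(** * Independence of disjoint subfamilies of a sample *)

(** Only second moments of the coordinates are available, so the square integrability of a product
    m_s v_s has to come from independence, together with the factorization of its moments.
    Independence is given for single sample points and must reach measurable functions of whole
    groups of blocks; hence the statistics are written as functions of one data tuple, and
    independence is transported along maps that erase the other blocks. The copies muh and nuh are
    described by their separate laws, whereas the degenerate case relies on the joint behaviour of
    C_b and its inverse, so it is argued inside one actual block. There the cross term Tr(Var(muh)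
    Var(nuh)) is read as E[y^T Var(nuh) y], the mean of a nonnegative function of y, whatever the
    coupling of y with z; this is why its vanishing constrains y almost surely. *)

Section TupleLaws.
Context d (T : measurableType d) (R : realType).

Definition box n (A : 'I_n -> set T) : set (n.-tuple T) :=
  [set t | forall i, A i (tnth t i)].

Definition boxes n : set_system (n.-tuple T) :=
  [set box A | A in [set A : 'I_n -> set T | forall i, measurable (A i)]].

Lemma box_bigcap n (A : 'I_n -> set T) :
  box A = \bigcap_(i in [set: 'I_n]) (fun t : n.-tuple T => tnth t i) @^-1` A i.
Proof. by apply/seteqP; split => t /= h i; [move=> _; exact: h | exact: h]. Qed.

Lemma measurable_box n (A : 'I_n -> set T) :
  (forall i, measurable (A i)) -> measurable (box A).
Proof.
move=> mA; rewrite box_bigcap; apply: fin_bigcap_measurable => // i _.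
by rewrite -[X in measurable X]setTI; exact: measurable_tnth.
Qed.

Lemma measurable_tupleE n :
  @measurable _ (n.-tuple T) = <<s @boxes n >>.
Proof.
apply/seteqP; split; last first.
  apply: smallest_sub; first exact: sigma_algebra_measurable.
  by move=> _ [A mA <-]; exact: measurable_box.
apply: smallest_sub; first exact: smallest_sigma_algebra.
move=> B; rewrite -bigcup_seq => -[i _ [A mA <-]].
apply: sub_sigma_algebra.
exists (fun j => if j == i then A else setT).
  by move=> j; case: ifP.
apply/seteqP; split => t /=.
  by move=> /(_ i); rewrite eqxx.
by move=> [_ At] j; case: ifP => // /eqP ->.
Qed.

Lemma setI_closed_boxes n : setI_closed (@boxes n).
Proof.
move=> _ _ [A mA <-] [A' mA' <-]; exists (fun i => A i `&` A' i).
  by move=> i; exact: measurableI.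
apply/seteqP; split => t /=; first by move=> h; split => i; have [] := h i.
by move=> [h h'] i; split; [exact: h|exact: h'].
Qed.

(** Boxes form a pi-system that generates the product sigma-algebra and contains the whole space, so
    Dynkin's uniqueness argument applies to finite measures. *)
Lemma tuple_measure_unique n (m1 m2 : {measure set n.-tuple T -> \bar R}) :
  (m1 setT < +oo)%E ->
  (forall A, (forall i, measurable (A i)) -> m1 (box A) = m2 (box A)) ->
  forall B, measurable B -> m1 B = m2 B.
Proof.
move=> m1oo m12 B mB.
have boxT : box (fun _ : 'I_n => [set: T]) = setT by apply/seteqP; split.
apply: (measure_unique (@boxes n) (fun _ => setT)) => //.
- exact: measurable_tupleE.
- exact: setI_closed_boxes.
- by move=> _; exists (fun=> setT).
- by rewrite bigcup_const//; exists 0.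
- by move=> _ [A mA <-]; exact: m12.
Qed.

End TupleLaws.

Section TupleVariables.
Context d (T : measurableType d) d' (Omega : measurableType d') (R : realType).
Variable P : probability Omega R.

Lemma measurable_preimage d1 (T1 : measurableType d1) (U : Omega -> T1) B :
  measurable_fun setT U -> measurable B -> measurable (U @^-1` B).
Proof. by move=> mU mB; rewrite -[X in measurable X]setTI; exact: mU. Qed.

Lemma tuple_law_unique n (U U' : Omega -> n.-tuple T) :
  measurable_fun setT U -> measurable_fun setT U' ->
  (forall A, (forall i, measurable (A i)) ->
    P (U @^-1` box A) = P (U' @^-1` box A)) ->
  forall B, measurable B -> P (U @^-1` B) = P (U' @^-1` B).
Proof.
move=> mU mU' UU' B mB.
pose law := measure_function_pushforward__canonical__measure_function_Measure.
apply: (@tuple_measure_unique _ _ _ _ (law _ _ _ _ _ P _ mU) (law _ _ _ _ _ P _ mU')) => //.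
by rewrite /= /pushforward preimage_setT probability_setT ltry.
Qed.

(** For fixed [E], both sides are finite measures in [B]: the law of [U] under P restricted to [E],
    and the law of [U] scaled by [P E]. *)
Lemma indep_event_tuple n (U : Omega -> n.-tuple T) (E : set Omega) :
  measurable_fun setT U -> measurable E ->
  (forall A, (forall i, measurable (A i)) ->
    P (U @^-1` box A `&` E) = P (U @^-1` box A) * P E)%E ->
  forall B, measurable B -> (P (U @^-1` B `&` E) = P (U @^-1` B) * P E)%E.
Proof.
move=> mU mE UE B mB.
pose law := measure_function_pushforward__canonical__measure_function_Measure.
have PE0 : (0 <= fine (P E))%R by rewrite fine_ge0.
have scaleE A : (P A * P E)%E = mscale (NngNum PE0) P A.
  by rewrite /mscale/= fineK ?fin_num_measure// muleC.
rewrite scaleE.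
apply: (@tuple_measure_unique _ _ _ _ (law _ _ _ _ _ (mrestr P mE) _ mU)
  (law _ _ _ _ _ (mscale (NngNum PE0) P) _ mU)) => //.
  rewrite /= /pushforward preimage_setT /mrestr setTI.
  by rewrite (le_lt_trans (probability_le1 _ mE))// ltry.
by move=> A mA /=; rewrite /pushforward -scaleE -UE.
Qed.

Lemma indep_tuple n m (U : Omega -> n.-tuple T) (W : Omega -> m.-tuple T) :
  measurable_fun setT U -> measurable_fun setT W ->
  (forall A A', (forall i, measurable (A i)) -> (forall i, measurable (A' i)) ->
    P (U @^-1` box A `&` W @^-1` box A') =
    P (U @^-1` box A) * P (W @^-1` box A'))%E ->
  forall B B', measurable B -> measurable B' ->
    (P (U @^-1` B `&` W @^-1` B') = P (U @^-1` B) * P (W @^-1` B'))%E.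
Proof.
move=> mU mW UW B B' mB mB'.
(* Boxes are replaced by measurable sets one variable at a time: first for [U] with the event on [W]
   fixed, then for [W] with [U] in a box. *)
apply: indep_event_tuple => //; first exact: measurable_preimage.
move=> A mA; rewrite setIC muleC; apply: indep_event_tuple => //.
  by apply: measurable_preimage => //; exact: measurable_box.
by move=> A' mA'; rewrite setIC muleC; exact: UW.
Qed.

End TupleVariables.

Section Mask.
Context d (T : measurableType d) d' (Omega : measurableType d') (R : realType).
Variable P : probability Omega R.
Context (N : nat) (x : 'I_N -> Omega -> T) (t0 : T).
Hypothesis mx : forall i, measurable_fun setT (x i).

(* keeps the variables of index in J, so that a function of a subfamily can be
   seen as a function of the whole family *)
Definition mask (J : {set 'I_N}) (w : Omega) : N.-tuple T :=
  [tuple if i \in J then x i w else t0 | i < N].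

Lemma measurable_mask J : measurable_fun setT (mask J).
Proof.
apply/measurable_fun_tnthP => i.
rewrite [X in measurable_fun _ X](_ : _ = if i \in J then x i else cst t0).
  by case: ifP.
by apply/funext => w /=; rewrite tnth_mktuple; case: ifP.
Qed.

Hypothesis indep_x : forall (J : {set 'I_N}) (A : 'I_N -> set T),
  (forall i, measurable (A i)) ->
  P (\bigcap_(i in [set` J]) (x i @^-1` A i)) =
  (\prod_(i in J) P (x i @^-1` A i))%E.

(** A coordinate outside [J] is the constant [t0], so its constraint holds everywhere or nowhere. *)
Lemma preimage_mask_box J (A : 'I_N -> set T) :
  mask J @^-1` box A = if `[< forall i, i \notin J -> A i t0 >]
    then \bigcap_(i in [set` J]) (x i @^-1` A i) else set0.
Proof.
case: asboolP => At0.
  apply/seteqP; split => w /= h i.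
    by move=> iJ; have := h i; rewrite tnth_mktuple iJ.
  by rewrite tnth_mktuple; case: ifPn => iJ; [exact: h|exact: At0].
apply/seteqP; split => w //= h; apply: At0 => i iJ.
by have := h i; rewrite tnth_mktuple (negbTE iJ).
Qed.

Lemma indep_mask (J K : {set 'I_N}) : (forall i, i \in J -> i \notin K) ->
  forall B B', measurable B -> measurable B' ->
  (P (mask J @^-1` B `&` mask K @^-1` B') =
   P (mask J @^-1` B) * P (mask K @^-1` B'))%E.
Proof.
move=> JK; apply: indep_tuple; [exact: measurable_mask..|move=> A A' mA mA'].
rewrite !preimage_mask_box; case: asboolP => _; last first.
  by rewrite set0I measure0 mul0e.
case: asboolP => _; last by rewrite setI0 measure0 mule0.
(* Gluing the two boxes turns the joint event into one intersection over the union of [J] and [K],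
   to which the product formula applies. *)
pose AA i := if i \in J then A i else A' i.
have KJ i : i \in K -> (i \in J) = false.
  by move=> iK; apply/negbTE/negP => /JK; rewrite iK.
have -> : \bigcap_(i in [set` J]) (x i @^-1` A i) `&`
    \bigcap_(i in [set` K]) (x i @^-1` A' i) =
    \bigcap_(i in [set` (J :|: K)%SET]) (x i @^-1` AA i).
  apply/seteqP; split => [w /= [hJ hK] i|w /= h].
    by rewrite /= inE /AA => /orP[iJ|iK];
      [rewrite iJ; exact: hJ|rewrite KJ//; exact: hK].
  split=> i /= iJK; have := h i; rewrite /= inE iJK ?orbT /AA.
    by rewrite iJK; exact.
  by rewrite KJ//; exact.
rewrite !indep_x//; last by move=> i; rewrite /AA; case: ifP.
rewrite (eq_bigl (fun i => i \in [predU J & K])); last by move=> i; rewrite !inE.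
rewrite bigU//=; last first.
  by apply/pred0P => i /=; apply/negbTE/negP => /andP[/JK/negbTE->].
congr (_ * _)%E; apply: eq_bigr => i iJ; rewrite /AA ?iJ//.
by rewrite KJ.
Qed.

End Mask.

(** * Real-valued expectation *)

Section Expectation.
Context d (Omega : measurableType d) (R : realType) (P : probability Omega R).

Lemma Lfun_measurable (f : Omega -> R) r :
  f \in Lfun P r -> measurable_fun setT f.
Proof. by rewrite inE => /andP[]; rewrite inE. Qed.

Lemma Lfun2_Lfun1 (f : Omega -> R) : f \in Lfun P 2%:E -> f \in Lfun P 1.
Proof. by apply: Lfun_subset12; exact: fin_num_measure. Qed.

Lemma Lfun_scalel (a : R) (f : Omega -> R) r : 1 <= r ->
  f \in Lfun P r%:E -> (fun w => a * f w) \in Lfun P r%:E.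
Proof.
move=> r1 fr; have -> : (fun w => a * f w) = a \o* f.
  by apply/funext => w /=; rewrite mulrC.
exact: Lfun_scale.
Qed.

Lemma Lfun_add (f g : Omega -> R) r : 1 <= r ->
  f \in Lfun P r%:E -> g \in Lfun P r%:E ->
  (fun w => f w + g w) \in Lfun P r%:E.
Proof.
move=> r1; have r1E : (1 <= r%:E)%E by rewrite lee_fin.
by have [_] := Lfun_addr_closed P r1E; exact.
Qed.

Lemma Lfun_sum I (s : seq I) (Q : pred I) (f : I -> Omega -> R) r : 1 <= r ->
  (forall i, Q i -> f i \in Lfun P r%:E) ->
  (fun w => \sum_(i <- s | Q i) f i w) \in Lfun P r%:E.
Proof.
move=> r1 fr; elim: s => [|i s IH].
  rewrite (_ : (fun _ => _) = cst 0); first exact: Lfun_cst.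
  by apply/funext => w; rewrite big_nil.
rewrite (_ : (fun _ => _) = fun w => (if Q i then f i w else 0) +
    \sum_(j <- s | Q j) f j w); last first.
  by apply/funext => w; rewrite big_cons; case: ifP => //; rewrite add0r.
apply: Lfun_add => //; case Qi: (Q i); [exact: fr|exact: Lfun_cst].
Qed.

Lemma Lfun2_mul (f g : Omega -> R) : f \in Lfun P 2%:E -> g \in Lfun P 2%:E ->
  (fun w => f w * g w) \in Lfun P 1.
Proof. exact: Lfun2_mul_Lfun1. Qed.

(** Reduces square integrability to integrability of a product, a form that passes through equality
    of laws and through independence. *)
Lemma Lfun2P (f : Omega -> R) : measurable_fun setT f ->
  (fun w => f w * f w) \in Lfun P 1 -> f \in Lfun P 2%:E.
Proof.
move=> mf /Lfun1_integrable /integrableP[_ foo].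
rewrite inE; apply/andP; split; rewrite inE//=.
rewrite /finite_norm unlock /Lnorm poweR_lty//.
apply: le_lt_trans foo; rewrite le_eqVlt; apply/orP; left; apply/eqP.
apply: eq_integral => w _ /=.
by rewrite powR_mulrn// normrM expr2.
Qed.

(** [fine] sends infinite values to 0, hence the integrability hypotheses of the linearity rules. *)
Definition rE (f : Omega -> R) : R := fine 'E_P[f]%E.

Lemma rEK f : f \in Lfun P 1 -> ('E_P[f] = (rE f)%:E)%E.
Proof. by move=> f1; rewrite fineK// expectation_fin_num. Qed.

Lemma rE_scalel a f : f \in Lfun P 1 -> rE (fun w => a * f w) = a * rE f.
Proof.
move=> f1; have -> : (fun w => a * f w) = a \o* f.
  by apply/funext => w /=; rewrite mulrC.
by rewrite /rE expectationZl// fineM ?expectation_fin_num.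
Qed.

Lemma rE_cst c : rE (fun=> c) = c.
Proof. by rewrite /rE expectation_cst. Qed.

Lemma rE_add f g : f \in Lfun P 1 -> g \in Lfun P 1 ->
  rE (fun w => f w + g w) = rE f + rE g.
Proof.
by move=> f1 g1; rewrite /rE expectationD// fineD// expectation_fin_num.
Qed.

Lemma rE_sub f g : f \in Lfun P 1 -> g \in Lfun P 1 ->
  rE (fun w => f w - g w) = rE f - rE g.
Proof.
by move=> f1 g1; rewrite /rE expectationB// fineB// expectation_fin_num.
Qed.

Lemma rE_sum I (s : seq I) (Q : pred I) (f : I -> Omega -> R) :
  (forall i, Q i -> f i \in Lfun P 1) ->
  rE (fun w => \sum_(i <- s | Q i) f i w) = \sum_(i <- s | Q i) rE (f i).
Proof.
move=> f1; elim: s => [|i s IH].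
  by rewrite big_nil -[RHS](rE_cst 0); congr rE; apply/funext => w; rewrite big_nil.
rewrite big_cons -IH.
rewrite (_ : (fun _ => _) = fun w => (if Q i then f i w else 0) +
    \sum_(j <- s | Q j) f j w); last first.
  by apply/funext => w; rewrite big_cons; case: ifP => //; rewrite add0r.
case Qi: (Q i); last by congr rE; apply/funext => w; rewrite add0r.
by rewrite rE_add//; [exact: f1|exact: (Lfun_sum _ (lexx 1))].
Qed.

Lemma rE_ge0 f : (forall w, 0 <= f w) -> 0 <= rE f.
Proof. by move=> f0; rewrite fine_ge0// expectation_ge0. Qed.

Lemma ae_eq_rE f g : measurable_fun setT f -> measurable_fun setT g ->
  {ae P, forall w, f w = g w} -> rE f = rE g.
Proof.
move=> mf mg fg; rewrite /rE unlock; congr fine; apply: ae_eq_integral => //.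
- exact/measurable_EFinP.
- exact/measurable_EFinP.
- by apply: filterS fg => w /= ->.
Qed.

Lemma rE_eq0_ae f : (forall w, 0 <= f w) -> f \in Lfun P 1 -> rE f = 0 ->
  {ae P, forall w, f w = 0}.
Proof.
move=> f0 f1 Ef0; have := rEK f1; rewrite Ef0 unlock => If.
have : (\int[P]_w `|(f w)%:E| = 0)%E.
  transitivity (\int[P]_w (f w)%:E)%E => //.
  by apply: eq_integral => w _; rewrite gee0_abs// lee_fin.
move/ae_eq_integral_abs => h.
have mf : measurable_fun setT (EFin \o f).
  by apply/measurable_EFinP; exact: Lfun_measurable f1.
have := h measurableT mf; apply: filterS => w /(_ I) /= [].
by [].
Qed.

Lemma ae_finP (I : finType) (Q : I -> Omega -> Prop) :
  (forall i, {ae P, forall w, Q i w}) -> {ae P, forall w, forall i, Q i w}.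
Proof.
move=> h; have : {ae P, forall w, forall i, i \in enum I -> Q i w}.
  elim: (enum I) => [|i s IH]; first by apply: nearW.
  apply: filterS2 (h i) IH => w Qi Qs j.
  by rewrite inE => /orP[/eqP->|/Qs].
by apply: filterS => w hw i; apply: hw; rewrite mem_enum.
Qed.

Lemma rE_covariance f g : f \in Lfun P 2%:E -> g \in Lfun P 2%:E ->
  covariance P f g = (rE (fun w => f w * g w) - rE f * rE g)%:E.
Proof.
move=> f2 g2; have fg1 := Lfun2_mul f2 g2.
have f1 := Lfun2_Lfun1 f2; have g1 := Lfun2_Lfun1 g2.
by rewrite covarianceE// !rEK// -EFinM -EFinB.
Qed.

End Expectation.

(** * Equality of laws, and products of independent variables *)

Section LawTransfer.
Context d (Omega : measurableType d) (R : realType) (P : probability Omega R).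
Context d1 (T1 : measurableType d1).

Section EqualLaw.
Variables U U' : Omega -> T1.
Hypotheses (mU : measurable_fun setT U) (mU' : measurable_fun setT U').
Hypothesis UU' : forall B, measurable B -> P (U @^-1` B) = P (U' @^-1` B).

Lemma ge0_eq_law_integral (h : T1 -> \bar R) : measurable_fun setT h ->
  (forall t, 0 <= h t)%E -> (\int[P]_w h (U w) = \int[P]_w h (U' w))%E.
Proof.
move=> mh h0.
rewrite -[LHS](@ge0_integral_pushforward _ _ _ _ _ _ mU P setT h)//; last first.
rewrite -[RHS](@ge0_integral_pushforward _ _ _ _ _ _ mU' P setT h)//; last first.
pose law := measure_function_pushforward__canonical__measure_function_Measure.
apply: (@eq_measure_integral _ _ _ _ (law _ _ _ _ _ P _ mU') (law _ _ _ _ _ P _ mU)).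
by move=> A mA _; exact: UU'.
Qed.

(** The positive and negative parts are transferred separately, as nonnegative integrals. *)
Lemma eq_law_rE (h : T1 -> R) : measurable_fun setT h ->
  rE P (h \o U) = rE P (h \o U').
Proof.
move=> mh; have mh' : measurable_fun setT (EFin \o h) by apply/measurable_EFinP.
rewrite /rE unlock; congr fine.
change (\int[P]_w ((EFin \o h) \o U) w = \int[P]_w ((EFin \o h) \o U') w)%E.
rewrite integralE [RHS]integralE; congr (_ - _)%E.
  under eq_integral do rewrite funepos_comp/=.
  under [RHS]eq_integral do rewrite funepos_comp/=.
  by rewrite (ge0_eq_law_integral (h := (EFin \o h)^\+%E))//; exact: measurable_funepos.
under eq_integral do rewrite funeneg_comp/=.
under [RHS]eq_integral do rewrite funeneg_comp/=.
by rewrite (ge0_eq_law_integral (h := (EFin \o h)^\-%E))//; exact: measurable_funeneg.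
Qed.

Lemma eq_law_Lfun1 (h : T1 -> R) : measurable_fun setT h ->
  h \o U \in Lfun P 1 -> h \o U' \in Lfun P 1.
Proof.
move=> mh /Lfun1_integrable /integrableP[_ foo].
apply/Lfun1_integrable/integrableP; split.
  by apply/measurable_EFinP; exact: measurableT_comp.
rewrite -(ge0_eq_law_integral (h := fun t => `|(h t)%:E|%E))//.
by apply: measurableT_comp => //; apply/measurable_EFinP.
Qed.

End EqualLaw.

Section Independent.
Context d2 (T2 : measurableType d2).
Variables (U : Omega -> T1) (W : Omega -> T2).
Hypotheses (mU : measurable_fun setT U) (mW : measurable_fun setT W).
Hypothesis UW : forall B B', measurable B -> measurable B' ->
  (P (U @^-1` B `&` W @^-1` B') = P (U @^-1` B) * P (W @^-1` B'))%E.
Variables (f : T1 -> R) (g : T2 -> R).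
Hypotheses (mf : measurable_fun setT f) (mg : measurable_fun setT g).
Hypotheses (fU : f \o U \in Lfun P 1) (gW : g \o W \in Lfun P 1).

(** Independence identifies the joint law with the product of the two laws; Tonelli then gives
    integrability from that of the factors, and Fubini the product formula. *)
Lemma indep_Lfun1_rE : (fun w => f (U w) * g (W w)) \in Lfun P 1 /\
  rE P (fun w => f (U w) * g (W w)) = rE P (f \o U) * rE P (g \o W).
Proof.
pose rU : {mfun Omega >-> T1} := HB.pack U (isMeasurableFun.Build _ _ _ _ U mU).
pose rW : {mfun Omega >-> T2} := HB.pack W (isMeasurableFun.Build _ _ _ _ W mW).
pose UW' w := (U w, W w).
have mUW : measurable_fun setT UW' by exact: measurable_fun_pair.
pose rUW : {mfun Omega >-> (T1 * T2)%type} :=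
  HB.pack UW' (isMeasurableFun.Build _ _ _ _ UW' mUW).
pose m1 := distribution P rU; pose m2 := distribution P rW.
pose h (t : T1 * T2) := (f t.1 * g t.2)%:E.
have mh : measurable_fun setT h.
  by apply/measurable_EFinP; apply: measurable_funM; exact: measurableT_comp.
have m12 X : measurable X -> (m1 \x m2)%E X = distribution P rUW X.
  by apply: product_measure_unique => A B mA mB; exact: UW.
have mf' : measurable_fun setT (EFin \o f) by apply/measurable_EFinP.
have mg' : measurable_fun setT (EFin \o g) by apply/measurable_EFinP.
have If := (Lfun1_integrable P (f \o U)).1 fU.
have Ig := (Lfun1_integrable P (g \o W)).1 gW.
have If1 : m1.-integrable setT (EFin \o f) by apply: integrable_pushforward.
have Ig2 : m2.-integrable setT (EFin \o g) by apply: integrable_pushforward.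
have Ih : (m1 \x m2)%E.-integrable setT h.
  apply/integrable12ltyP => //.
  under eq_integral => x _.
    under eq_integral => y _ do rewrite /h/= normrM EFinM.
    rewrite ge0_integralZl//=; last exact/measurable_EFinP/measurableT_comp.
    over.
  rewrite /= ge0_integralZr//; last 2 first.
    by apply/measurable_EFinP; exact: measurableT_comp.
    by apply: integral_ge0.
  move/integrableP : If1 => [_ If1]; move/integrableP : Ig2 => [_ Ig2].
  by rewrite lte_mul_pinfty// ?integral_ge0// ge0_fin_numE// integral_ge0.
have hP : P.-integrable setT (h \o UW').
  apply/integrableP; split; first exact: measurableT_comp.
  rewrite -(@ge0_integral_distribution _ _ _ _ _ P rUW (fun t => `|h t|%E))//; last first.
    exact: measurableT_comp.
  rewrite (eq_measure_integral (m1 \x m2)%E); last first.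
    by move=> A mA _; apply/esym; exact: m12.
  by case/integrableP : Ih.
split; first exact/Lfun1_integrable.
rewrite /rE -fineM ?expectation_fin_num//; congr fine.
rewrite unlock; transitivity (\int[distribution P rUW]_t h t)%E.
  by rewrite integral_distribution.
rewrite (eq_measure_integral (m1 \x m2)%E); last first.
    by move=> A mA _; apply/esym; exact: m12.
rewrite -integral12_prod_meas1//= /fubini_F.
have intU : (\int[P]_w (f (U w))%:E = \int[m1]_t (f t)%:E)%E.
  by rewrite (@integral_distribution _ _ _ _ _ P rU (EFin \o f)).
have intW : (\int[P]_w (g (W w))%:E = \int[m2]_t (g t)%:E)%E.
  by rewrite (@integral_distribution _ _ _ _ _ P rW (EFin \o g)).
rewrite /= intU intW.
under eq_integral => x _.
  under eq_integral => y _ do rewrite /h/= EFinM.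
  rewrite integralZl//.
  over.
have g_fin : (\int[m2]_t (g t)%:E)%E \is a fin_num by exact: integrable_fin_num.
by rewrite /= -(fineK g_fin) integralZr.
Qed.

End Independent.

End LawTransfer.

(** * Expectation under a density *)

Section Density.
Context d (Omega : measurableType d) (R : realType) (P : probability Omega R).
Context d1 (T : measurableType d1) (mu : {measure set T -> \bar R}).
Variables (X : set T) (p : T -> R) (x : Omega -> T).
Hypotheses (mX : measurable X) (mp : measurable_fun X p).
Hypothesis p0 : forall t, X t -> 0 <= p t.
Hypothesis mx : measurable_fun setT x.
Hypothesis xp : forall A, measurable A ->
  P (x @^-1` A) = (\int[mu]_(t in A `&` X) (p t)%:E)%E.

Import HBNNSimple.

(** The usual extension from indicators, where the claim is the hypothesis on the law, to simple
    functions by linearity and then by monotone convergence. *)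
Lemma ge0_integral_density (h : T -> \bar R) : measurable_fun setT h ->
  (forall t, 0 <= h t)%E ->
  (\int[P]_w h (x w) = \int[mu]_(t in X) (h t * (p t)%:E))%E.
Proof.
move=> mh h0; pose rx : {mfun Omega >-> T} :=
  HB.pack x (isMeasurableFun.Build _ _ _ _ x mx).
pose nu := distribution P rx; pose g t := (p t)%:E.
have mg : measurable_fun X g by apply/measurable_EFinP.
have g0 t : X t -> (0 <= g t)%E by move=> Xt; rewrite lee_fin p0.
rewrite -[LHS](@ge0_integral_distribution _ _ _ _ _ P rx h)// -/nu.
pose H := nnsfun_approx measurableT mh.
have -> : (\int[nu]_t h t = lim (\int[nu]_t (H n t)%:E @[n --> \oo]))%E.
  have hE t : h t = lim ((EFin \o H n) t @[n --> \oo]).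
    by apply/esym/cvg_lim => //; exact: cvg_nnsfun_approx.
  under eq_integral => t _ do rewrite hE.
  apply: monotone_convergence => //.
  - by move=> n; exact/measurable_EFinP.
  - by move=> n t _ /=; rewrite lee_fin.
  - by move=> t _ a b ab; rewrite lee_fin; exact/lefP/nd_nnsfun_approx.
have -> : (\int[mu]_(t in X) (h t * g t) =
    lim (\int[mu]_(t in X) ((EFin \o H n) \* g) t @[n --> \oo]))%E.
  have hE t : (h t * g t)%E = lim (((EFin \o H n) \* g)%E t @[n --> \oo]).
    by apply/esym/cvg_lim => //; apply: cvgeZr => //; exact: cvg_nnsfun_approx.
  under eq_integral => t _ do rewrite hE.
  apply: monotone_convergence => //.
  - move=> n; apply/emeasurable_funM => //; apply: measurable_funTS.
    exact/measurable_EFinP.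
  - by move=> n t Xt; apply: mule_ge0; [rewrite lee_fin; exact: fun_ge0|exact: g0].
  - move=> t Xt a b ab /=; rewrite lee_wpmul2r ?lee_fin ?g0 ?p0//.
    exact/lefP/nd_nnsfun_approx.
suff suf n : (\int[mu]_(t in X) ((EFin \o H n) t * g t) =
    \int[nu]_t (EFin \o H n) t)%E.
  by apply/esym; under eq_fun do rewrite suf.
transitivity (\int[nu]_t
   (\sum_(y \in range (H n)) (y * \1_(H n @^-1` [set y]) t)%:E))%E; last first.
  by apply: eq_integral => t _; rewrite /= fimfunE -fsumEFin.
have indich r D : measurable_fun D (fun t => (r * \1_(H n @^-1` [set r]) t)%:E).
  apply: measurable_funTS; apply/measurable_EFinP.
  exact: measurable_funM.
rewrite ge0_integral_fsum//; last by move=> y t _; exact: nnfun_muleindic_ge0.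
transitivity (\int[mu]_(t in X) (\sum_(y \in range (H n))
    (y * \1_(H n @^-1` [set y]) t)%:E * g t))%E.
  under [RHS]eq_integral => t tX.
    rewrite -ge0_mule_fsuml => [|y]; last exact: nnfun_muleindic_ge0.
    rewrite fsumEFin // -(fimfunE _ t); over.
  by [].
rewrite ge0_integral_fsum//; last 2 first.
  - by move=> y; apply: emeasurable_funM.
  - by move=> y t Xt; apply: mule_ge0; [exact: nnfun_muleindic_ge0|exact: g0].
apply: eq_fsbigr => r rhn.
under [RHS]eq_integral do rewrite EFinM.
rewrite integralZl_indic_nnsfun => //.
under eq_integral do rewrite EFinM -muleA.
rewrite ge0_integralZl//.
- under eq_integral do rewrite muleC.
  rewrite (eq_integral (g \_ (H n @^-1` [set r]))); last first.
    by move=> t _; rewrite epatch_indic.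
  rewrite -integral_mkcondr integral_indic// setIT.
  by rewrite /nu/= /distribution/= /pushforward/= xp// setIC.
- apply: emeasurable_funM => //; apply: measurable_funTS.
  exact/measurable_EFinP.
- by move=> t Xt; apply: mule_ge0; [rewrite lee_fin|exact: g0].
- by move: rhn; rewrite inE => -[t _ <-]; rewrite lee_fin.
Qed.

Lemma rE_density (h : T -> R) : measurable_fun setT h ->
  mu.-integrable X (fun t => (h t * p t)%:E) ->
  (h \o x \in Lfun P 1) /\ rE P (h \o x) = \int[mu]_(t in X) (h t * p t).
Proof.
move=> mh /integrableP[mhp hpoo].
have mh' : measurable_fun setT (EFin \o h) by apply/measurable_EFinP.
have hx1 : P.-integrable setT (EFin \o (h \o x)).
  apply/integrableP; split.
    by apply/measurable_EFinP; exact: measurableT_comp.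
  rewrite (ge0_integral_density (h := fun t => `|(h t)%:E|%E))//; last first.
    exact: measurableT_comp.
  apply: le_lt_trans hpoo; rewrite le_eqVlt; apply/orP; left; apply/eqP.
  apply: eq_integral => t; rewrite inE => Xt.
  by rewrite EFinM abseM (gee0_abs (x := (p t)%:E))// lee_fin p0.
split; first exact/Lfun1_integrable.
rewrite /rE /Rintegral unlock; congr fine.
change (\int[P]_w ((EFin \o h) \o x) w = \int[mu]_(t in X) (h t * p t)%:E)%E.
rewrite [LHS]integralE [RHS]integralE; congr (_ - _)%E.
  under eq_integral do rewrite funepos_comp/=.
  rewrite (ge0_integral_density (h := (EFin \o h)^\+%E))//; last first.
    exact: measurable_funepos.
  (* Since [p] is nonnegative on [X], multiplying by it commutes with taking positive parts. *)
  apply: eq_integral => t; rewrite inE => Xt; rewrite !funeposE /= EFinM.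
  by rewrite maxe_pMl ?lee_fin ?p0// mul0e.
under eq_integral do rewrite funeneg_comp/=.
rewrite (ge0_integral_density (h := (EFin \o h)^\-%E))//; last first.
  exact: measurable_funeneg.
apply: eq_integral => t; rewrite inE => Xt; rewrite !funenegE /= -mulNr EFinM.
by rewrite maxe_pMl ?lee_fin ?p0// mul0e.
Qed.

End Density.

(** * Optimal integer split *)

Section Allocation.
Variable R : realType.
Implicit Types (k m : nat).

Definition split_cost (a1 a2 T u : R) : R := a1 / u + a2 / (T - u).

Lemma split_cost_sym (a1 a2 T u : R) :
  split_cost a1 a2 T u = split_cost a2 a1 T (T - u).
Proof. by rewrite /split_cost addrC opprB addrCA subrr addr0. Qed.

(* the equation says that t is the critical point of the cost *)
Lemma split_cost_mono (a1 a2 T t u v : R) : 0 <= a1 -> 0 <= a2 ->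
  a1 * (T - t) ^+ 2 = a2 * t ^+ 2 -> 0 < t -> t <= u -> u <= v -> v < T ->
  split_cost a1 a2 T u <= split_cost a1 a2 T v.
Proof.
move=> a1_ge0 a2_ge0 crit t0 tu uv vT.
have u0 : 0 < u by exact: lt_le_trans tu.
have v0 : 0 < v by exact: lt_le_trans uv.
have Tv0 : 0 < T - v by rewrite subr_gt0.
have Tu0 : 0 < T - u by rewrite subr_gt0; exact: le_lt_trans uv vT.
(* The increase of the cost from u to v has the sign of a2 u v - a1 (T - u) (T - v). As t <= u <= v,
   the common value in the critical equation separates the two products. *)
have key : a1 * ((T - u) * (T - v)) <= a2 * (u * v).
  apply: (@le_trans _ _ (a1 * (T - t) ^+ 2)).
    rewrite ler_wpM2l// expr2 ler_pM ?(ltW Tu0) ?(ltW Tv0)//.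
      by rewrite lerD2l lerN2.
    by rewrite lerD2l lerN2 (le_trans tu).
  rewrite crit ler_wpM2l// expr2 ler_pM ?(ltW t0)//.
  exact: le_trans uv.
rewrite -subr_ge0 /split_cost.
have -> : a1 / v + a2 / (T - v) - (a1 / u + a2 / (T - u)) =
    (v - u) * (a2 * (u * v) - a1 * ((T - u) * (T - v))) /
    (u * v * ((T - u) * (T - v))).
  by field; rewrite !gt_eqF.
apply: divr_ge0; first by rewrite mulr_ge0// subr_ge0.
by apply/ltW; rewrite !mulr_gt0.
Qed.

(** Unimodality leaves the two integers around [t]; the case analysis handles a floor equal to 0 or
    a ceiling equal to [B], which are not admissible splits. *)
Lemma split_cost_argmin (a1 a2 t : R) (B : nat) : 0 <= a1 -> 0 <= a2 -> (1 < B)%N ->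
  0 < t -> t < B%:R -> a1 * (B%:R - t) ^+ 2 = a2 * t ^+ 2 ->
  exists k, [/\ k%:Z = Num.floor t \/ k%:Z = Num.ceil t, (0 < k < B)%N &
    forall m, (0 < m < B)%N ->
      split_cost a1 a2 B%:R k%:R <= split_cost a1 a2 B%:R m%:R].
Proof.
move=> a1_ge0 a2_ge0 B1 t0 tB crit.
have right k m : t <= k%:R -> (k <= m < B)%N ->
    split_cost a1 a2 B%:R k%:R <= split_cost a1 a2 B%:R m%:R.
  move=> tk /andP[km mB].
  by apply: (split_cost_mono a1_ge0 a2_ge0 crit) => //; rewrite ?ler_nat ?ltr_nat.
(* The reflection u -> B - u swaps the two weights, so the decreasing side follows from the
   increasing one. *)
have left k m : k%:R <= t -> (0 < m <= k)%N ->
    split_cost a1 a2 B%:R k%:R <= split_cost a1 a2 B%:R m%:R.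
  move=> kt /andP[m0 mk]; rewrite 2!(split_cost_sym a1).
  apply: (@split_cost_mono _ _ _ (B%:R - t)) => //.
  - by rewrite opprB addrCA subrr addr0 crit.
  - by rewrite subr_gt0.
  - by rewrite lerD2l lerN2.
  - by rewrite lerD2l lerN2 ler_nat.
  - by rewrite ltrBlDr ltrDl ltr0n.
have [f fE] : exists f : nat, f%:Z = Num.floor t.
  by exists `|Num.floor t|%N; rewrite gez0_abs// floor_ge0 ltW.
have ft : f%:R <= t by have := floor_le t; rewrite -fE.
have tf : t < f.+1%:R.
  by have := floorD1_gt t; rewrite -fE -natr1 intrD.
(* For an integer [t] the ceiling is [f] and not [f.+1], so this case is separate. *)
have [tE|tf0] := eqVneq t f%:R.
  exists f; split; first by left.
    by rewrite -(ltr0n R) -(ltr_nat R) -tE t0.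
  move=> m /andP[m0 mB]; have [fm|/ltnW mf] := leqP f m.
    by apply: right; rewrite ?tE// fm.
  by apply: left; rewrite ?tE// m0.
have cE : f.+1%:Z = Num.ceil t.
  apply/esym/ceil_def; rewrite [f.+1%:Z - 1](_ : _ = f%:Z); last first.
    by rewrite -addn1 PoszD addrK.
  by apply/andP; split; [rewrite -pmulrn lt_neqAle eq_sym tf0|exact: ltW tf].
have fB : (f < B)%N by rewrite -(ltr_nat R) (le_lt_trans ft).
have [f0|f_gt0] := posnP f.
  exists 1%N; split; [by right; rewrite -cE f0|by rewrite B1|].
  move=> m /andP[m0 mB]; apply: right; last by rewrite m0.
  by rewrite ltW//; rewrite f0 in tf.
have [cB|cB] := eqVneq f.+1 B.
  exists f; split; [by left|by rewrite f_gt0|].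
  by move=> m /andP[m0 mB]; apply: left; rewrite // m0 -ltnS cB.
have {}cB : (f.+1 < B)%N by rewrite ltn_neqAle cB.
have minE k : split_cost a1 a2 B%:R k%:R <= split_cost a1 a2 B%:R f%:R ->
    split_cost a1 a2 B%:R k%:R <= split_cost a1 a2 B%:R f.+1%:R ->
    forall m, (0 < m < B)%N ->
      split_cost a1 a2 B%:R k%:R <= split_cost a1 a2 B%:R m%:R.
  move=> kf kc m /andP[m0 mB]; have [mf|fm] := leqP m f.
    by apply: le_trans kf _; apply: left; rewrite ?m0.
  by apply: le_trans kc _; apply: right; rewrite ?fm// ltW.
have [fc|cf] := leP (split_cost a1 a2 B%:R f%:R) (split_cost a1 a2 B%:R f.+1%:R).
  by exists f; split; [left|rewrite f_gt0|exact: minE].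
by exists f.+1; split; [right|rewrite cB|apply: minE => //; exact: ltW].
Qed.

(** For distinct weights with square roots s1 and s2, the quotient (s1^2 - s1 s2) / (s1^2 - s2^2) is
    s1 / (s1 + s2), so t solves s1 (T - t) = s2 t, whose square is the critical equation. The
    dichotomy excludes exactly one zero weight, for which t would be an endpoint, but allows both to
    be zero. *)
Lemma critical_splitP (a1 a2 T t : R) : 0 <= a1 -> 0 <= a2 -> 0 < T ->
  a1 = a2 \/ (0 < a1 /\ 0 < a2) ->
  t = (if a1 != a2 then (a1 - Num.sqrt (a1 * a2)) / (a1 - a2) * T else T / 2) ->
  [/\ 0 < t, t < T & a1 * (T - t) ^+ 2 = a2 * t ^+ 2].
Proof.
move=> a1_ge0 a2_ge0 T0 a12; case: eqVneq => [-> /= ->|a1N2 /= ->].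
  by split; [lra|lra|field].
case: a12 a1N2 => [->|[a1_gt0 a2_gt0 a1N2]]; first by rewrite eqxx.
rewrite sqrtrM//; set s1 := Num.sqrt a1; set s2 := Num.sqrt a2.
have s1_gt0 : 0 < s1 by rewrite sqrtr_gt0.
have s2_gt0 : 0 < s2 by rewrite sqrtr_gt0.
have a1E : a1 = s1 ^+ 2 by rewrite sqr_sqrtr.
have a2E : a2 = s2 ^+ 2 by rewrite sqr_sqrtr.
have s12 : s1 - s2 != 0.
  by rewrite subr_eq0; apply: contraNneq a1N2 => s12; rewrite a1E a2E s12.
have s12' : 0 < s1 + s2 by rewrite addr_gt0.
have -> : (a1 - s1 * s2) / (a1 - a2) * T = s1 / (s1 + s2) * T.
  rewrite a1E a2E subr_sqr; field; rewrite s12 gt_eqF//.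
split.
- by rewrite mulr_gt0// divr_gt0.
- by rewrite gtr_pMl// ltr_pdivrMr// mul1r ltrDl.
- by rewrite a1E a2E; field; rewrite gt_eqF.
Qed.

End Allocation.

(** * Second moments of averages *)

Section Moments.
Context d (Omega : measurableType d) (R : realType) (P : probability Omega R).

Definition avg (Y : nat -> Omega -> R) (b0 b1 : nat) (w : Omega) : R :=
  (b1 - b0)%:R^-1 * \sum_(b0 <= a < b1) Y a w.

Lemma Lfun_big_nat (Y : nat -> Omega -> R) (r : R) b0 b1 : 1 <= r ->
  (forall a, (b0 <= a < b1)%N -> Y a \in Lfun P r%:E) ->
  (fun w => \sum_(b0 <= a < b1) Y a w) \in Lfun P r%:E.
Proof.
move=> r1 Yr.
have -> : (fun w => \sum_(b0 <= a < b1) Y a w) =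
    (fun w => \sum_(b0 <= a < b1 | (b0 <= a < b1)%N) Y a w).
  by apply/funext => w; rewrite big_nat.
exact: Lfun_sum.
Qed.

Lemma rE_big_nat (Y : nat -> Omega -> R) b0 b1 :
  (forall a, (b0 <= a < b1)%N -> Y a \in Lfun P 1) ->
  rE P (fun w => \sum_(b0 <= a < b1) Y a w) = \sum_(b0 <= a < b1) rE P (Y a).
Proof.
move=> Y1; rewrite [RHS]big_nat -rE_sum//; congr rE.
by apply/funext => w; rewrite big_nat.
Qed.

Lemma avg_Lfun (Y : nat -> Omega -> R) (r : R) b0 b1 : 1 <= r ->
  (forall a, (b0 <= a < b1)%N -> Y a \in Lfun P r%:E) ->
  avg Y b0 b1 \in Lfun P r%:E.
Proof. by move=> r1 Yr; apply: Lfun_scalel => //; exact: Lfun_big_nat. Qed.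

Lemma rE_avg (Y : nat -> Omega -> R) b0 b1 y : (b0 < b1)%N ->
  (forall a, (b0 <= a < b1)%N -> Y a \in Lfun P 1) ->
  (forall a, (b0 <= a < b1)%N -> rE P (Y a) = y) ->
  rE P (avg Y b0 b1) = y.
Proof.
move=> b01 Y1 Yy; rewrite rE_scalel; last exact: (Lfun_big_nat (lexx 1)).
rewrite rE_big_nat// (eq_big_nat _ _ Yy) sumr_const_nat -(mulr_natl y) mulrA.
by rewrite mulVf ?mul1r// pnatr_eq0 subn_eq0 -ltnNge.
Qed.

(** Each [a] meets exactly one coincident [b], because the second range contains the first. The
    double sum has mean (b1 - b0) ((c1 - c0) e + (q - e)), and the length b1 - b0 cancels: this is
    why H2 and H3 have the same bias. *)
Lemma rE_avg_mul (Y Z : nat -> Omega -> R) b0 b1 c0 c1 (e q : R) :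
  (b0 < b1)%N -> (c0 <= b0)%N -> (b1 <= c1)%N ->
  (forall a b, (c0 <= a < c1)%N -> (c0 <= b < c1)%N ->
    (fun w => Y a w * Z b w) \in Lfun P 1 /\
    rE P (fun w => Y a w * Z b w) = if a == b then q else e) ->
  (fun w => avg Y b0 b1 w * avg Z c0 c1 w) \in Lfun P 1 /\
  rE P (fun w => avg Y b0 b1 w * avg Z c0 c1 w) = e + (q - e) / (c1 - c0)%:R.
Proof.
move=> b01 cb0 bc1 YZ.
have lift a : (b0 <= a < b1)%N -> (c0 <= a < c1)%N.
  by move=> /andP[h1 h2]; rewrite (leq_trans cb0 h1) (leq_trans h2 bc1).
set kb := (b1 - b0)%:R : R; set kc := (c1 - c0)%:R : R.
have -> : (fun w => avg Y b0 b1 w * avg Z c0 c1 w) = (fun w => (kb * kc)^-1 *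
    \sum_(b0 <= a < b1) \sum_(c0 <= b < c1) Y a w * Z b w).
  apply/funext => w; rewrite /avg mulrACA invfM; congr (_ * _).
  by rewrite big_distrlr.
have L1 a : (b0 <= a < b1)%N ->
    (fun w => \sum_(c0 <= b < c1) Y a w * Z b w) \in Lfun P 1.
  move=> /lift ha; apply: (Lfun_big_nat (lexx 1)) => b hb.
  by have [] := YZ a b ha hb.
have E1 a : (b0 <= a < b1)%N ->
    rE P (fun w => \sum_(c0 <= b < c1) Y a w * Z b w) = kc * e + (q - e).
  move=> /lift ha; rewrite rE_big_nat; last by move=> b hb; have [] := YZ a b ha hb.
  rewrite (eq_big_nat _ _ (F2 := fun b => e + (if b == a then q - e else 0))).
    rewrite big_split/= sumr_const_nat -(mulr_natl e); congr (_ + _).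
    by rewrite -big_mkcond big_nat1_eq ha.
  move=> b hb; have [_ ->] := YZ a b ha hb.
  by rewrite eq_sym; case: eqP => _; rewrite ?addr0// addrC subrK.
split; first by apply: Lfun_scalel => //; exact: (Lfun_big_nat (lexx 1)).
rewrite rE_scalel; last exact: (Lfun_big_nat (lexx 1)).
rewrite rE_big_nat// (eq_big_nat _ _ E1) sumr_const_nat -(mulr_natl (_ + _)).
have kb0 : kb != 0 by rewrite pnatr_eq0 subn_eq0 -ltnNge.
have kc0 : kc != 0.
  by rewrite pnatr_eq0 subn_eq0 -ltnNge (leq_ltn_trans cb0)// (leq_trans b01).
by rewrite -/kb; field; rewrite kb0 kc0.
Qed.

(** Integrability of the product is part of the conclusion; applied to squares, it yields membership
    in L2. *)
Definition uncorrelated (f g : Omega -> R) : Prop :=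
  f \in Lfun P 1 -> g \in Lfun P 1 ->
  (fun w => f w * g w) \in Lfun P 1 /\
  rE P (fun w => f w * g w) = rE P f * rE P g.

Lemma variance_dot (I : finType) (m v : I -> Omega -> R) :
  (forall s, m s \in Lfun P 2%:E) -> (forall s, v s \in Lfun P 2%:E) ->
  (forall s, uncorrelated (m s) (v s)) ->
  (forall s t, uncorrelated (fun w => m s w * m t w) (fun w => v s w * v t w)) ->
  let f w := \sum_s m s w * v s w in
  [/\ f \in Lfun P 2%:E, rE P f = \sum_s rE P (m s) * rE P (v s) &
    ('V_P[f] = (\sum_s \sum_t rE P (fun w => m s w * m t w) *
      rE P (fun w => v s w * v t w) -
      (\sum_s rE P (m s) * rE P (v s)) ^+ 2)%:E)%E].
Proof.
move=> m2 v2 mv mmvv f.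
(* (m_s v_s)^2 is the product of two integrable uncorrelated squares, so second moments of the
   factors suffice. *)
have mv2 s : (fun w => m s w * v s w) \in Lfun P 2%:E.
  apply: Lfun2P.
    by apply: measurable_funM; apply: Lfun_measurable; [exact: m2|exact: v2].
  have [+ _] := mmvv s s (Lfun2_mul (m2 s) (m2 s)) (Lfun2_mul (v2 s) (v2 s)).
  by under eq_fun do rewrite mulrACA.
have f2 : f \in Lfun P 2%:E by apply: Lfun_sum => //; exact: ler1n.
have Ef : rE P f = \sum_s rE P (m s) * rE P (v s).
  rewrite rE_sum => [|s _]; last exact: Lfun2_Lfun1.
  by apply: eq_bigr => s _; case: (mv s (Lfun2_Lfun1 (m2 s)) (Lfun2_Lfun1 (v2 s))).
split => //; rewrite /variance rE_covariance// Ef -expr2; congr (_ - _)%:E.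
have -> : (fun w => f w * f w) = (fun w => \sum_s \sum_t
    (m s w * m t w) * (v s w * v t w)).
  apply/funext => w; rewrite big_distrlr/=.
  by apply: eq_bigr => s _; apply: eq_bigr => t _; rewrite mulrACA.
have L1 s t : (fun w => (m s w * m t w) * (v s w * v t w)) \in Lfun P 1.
  by have [] := mmvv s t (Lfun2_mul (m2 s) (m2 t)) (Lfun2_mul (v2 s) (v2 t)).
rewrite rE_sum => [|s _]; last by apply: (Lfun_sum _ (lexx 1)) => t _.
apply: eq_bigr => s _; rewrite rE_sum//; apply: eq_bigr => t _.
by have [] := mmvv s t (Lfun2_mul (m2 s) (m2 t)) (Lfun2_mul (v2 s) (v2 t)).
Qed.

Section TraceCovariance.
Variables (k : nat) (Y Z : 'I_k -> Omega -> R).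
Hypotheses (Y2 : forall s, Y s \in Lfun P 2%:E).
Hypotheses (Z2 : forall s, Z s \in Lfun P 2%:E).
Let C s t := rE P (fun w => Y s w * Y t w).
Let D s t := rE P (fun w => Z s w * Z t w).

Let comb_Lfun2 (c : 'I_k -> R) : (fun w => \sum_s c s * Z s w) \in Lfun P 2%:E.
Proof.
by apply: Lfun_sum => [|s _]; [exact: ler1n|apply: Lfun_scalel => //; exact: ler1n].
Qed.

(** This identity makes [D] positive semidefinite, and turns a zero of its form into a combination
    of the Z_s that vanishes a.s. *)
Lemma quad_covE (c : 'I_k -> R) : \sum_s \sum_t c s * c t * D s t =
  rE P (fun w => (\sum_s c s * Z s w) ^+ 2).
Proof.
have -> : (fun w => (\sum_s c s * Z s w) ^+ 2) =
    (fun w => \sum_s \sum_t (c s * c t) * (Z s w * Z t w)).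
  apply/funext => w; rewrite expr2 big_distrlr/=.
  by apply: eq_bigr => s _; apply: eq_bigr => t _; rewrite mulrACA.
have L1 s t : (fun w => Z s w * Z t w) \in Lfun P 1 by exact: Lfun2_mul.
rewrite rE_sum => [|s _]; last first.
  by apply: (Lfun_sum _ (lexx 1)) => t _; exact: Lfun_scalel.
apply: eq_bigr => s _; rewrite rE_sum => [|t _]; last exact: Lfun_scalel.
by apply: eq_bigr => t _; rewrite rE_scalel.
Qed.

Let quad_ge0 (c : 'I_k -> R) : 0 <= \sum_s \sum_t c s * c t * D s t.
Proof. by rewrite quad_covE; apply: rE_ge0 => w; exact: sqr_ge0. Qed.

Let quad_eq0 (c : 'I_k -> R) : \sum_s \sum_t c s * c t * D s t = 0 ->
  {ae P, forall w, \sum_s c s * Z s w = 0}.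
Proof.
rewrite quad_covE => /rE_eq0_ae h.
have := h (fun w => sqr_ge0 _) (Lfun2_mul (comb_Lfun2 c) (comb_Lfun2 c)).
by apply: filterS => w /eqP; rewrite sqrf_eq0 => /eqP.
Qed.

(** The quadratic form of the constant matrix [D] at the random vector [Y]. Its mean involves only
    the second moments of [Y], so it is the trace of the product of [C] and [D] for any joint law of
    [Y] and [Z]. *)
Let Q w := \sum_s \sum_t D s t * (Y s w * Y t w).

Let QE w : Q w = \sum_s \sum_t Y s w * Y t w * D s t.
Proof. by apply: eq_bigr => s _; apply: eq_bigr => t _; rewrite mulrC. Qed.

Let Q_ge0 w : 0 <= Q w.
Proof. by rewrite QE; exact: quad_ge0. Qed.

Let Q_Lfun1 : Q \in Lfun P 1.
Proof.
apply: (Lfun_sum _ (lexx 1)) => s _; apply: (Lfun_sum _ (lexx 1)) => t _.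
by apply: Lfun_scalel => //; exact: Lfun2_mul.
Qed.

Let rE_Q : rE P Q = \sum_s \sum_t C s t * D s t.
Proof.
have L1 s t : (fun w => D s t * (Y s w * Y t w)) \in Lfun P 1.
  by apply: Lfun_scalel => //; exact: Lfun2_mul.
rewrite rE_sum => [|s _]; last by apply: (Lfun_sum _ (lexx 1)) => t _.
apply: eq_bigr => s _; rewrite rE_sum//; apply: eq_bigr => t _.
by rewrite rE_scalel 1?mulrC//; exact: Lfun2_mul.
Qed.

Lemma trace_cov_ge0 : 0 <= \sum_s \sum_t C s t * D s t.
Proof. by rewrite -rE_Q; exact: rE_ge0. Qed.

(* Y lies a.s. in the kernel of the covariance of Z, which is a.s. orthogonal
   to Z *)
Lemma trace_cov_eq0 : \sum_s \sum_t C s t * D s t = 0 ->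
  {ae P, forall w, \sum_s Y s w * Z s w = 0}.
Proof.
rewrite -rE_Q => /(rE_eq0_ae Q_ge0 Q_Lfun1) Q0.
pose Dm : 'M[R]_k := \matrix_(s, t) D s t; pose K := kermx Dm.
(* The kernel vector [Y w] varies with [w], while each a.s. orthogonality concerns a fixed vector.
   The finitely many rows of [K] share one null set and span the kernel. *)
have Kdot i : {ae P, forall w, \sum_s K i s * Z s w = 0}.
  apply: quad_eq0.
  have /matrixP/(_ i) := mulmx_ker Dm; rewrite -/K => Ki.
  rewrite exchange_big/=; apply: big1 => t _.
  have := Ki t; rewrite !mxE => Kit.
  transitivity ((\sum_s K i s * Dm s t) * K i t); last by rewrite Kit mul0r.
  by rewrite big_distrl; apply: eq_bigr => s _; rewrite !mxE mulrAC.
have := ae_finP Kdot; apply: filterS2 Q0 => w; rewrite QE => Qw Kw.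
pose y : 'rV[R]_k := \row_s Y s w; pose z : 'cV[R]_k := \col_s Z s w.
(* With [w] fixed, [Y w] is a constant vector of zero quadratic form, so its product with [Z]
   vanishes for almost every [w']; the entries of y D are the means of this product times Z_t. *)
have yD : y *m Dm = 0.
  have Yz := quad_eq0 Qw.
  apply/matrixP => i t; rewrite !mxE.
  transitivity (rE P (fun w' => (\sum_s Y s w * Z s w') * Z t w')).
    have -> : (fun w' => (\sum_s Y s w * Z s w') * Z t w') =
        (fun w' => \sum_s Y s w * (Z s w' * Z t w')).
      by apply/funext => w'; rewrite big_distrl; apply: eq_bigr => s _; rewrite mulrA.
    rewrite rE_sum => [|s _]; last by apply: Lfun_scalel => //; exact: Lfun2_mul.
    apply: eq_bigr => s _; rewrite rE_scalel ?mxE//; exact: Lfun2_mul.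
  rewrite -[RHS](rE_cst P 0); apply: ae_eq_rE => //.
    exact: Lfun_measurable (Lfun2_mul (comb_Lfun2 _) (Z2 t)).
  by apply: filterS Yz => w' ->; rewrite mul0r.
have /submxP[c yE] : (y <= K)%MS by apply/sub_kermxP.
have Kz : K *m z = 0.
  apply/matrixP => i j; rewrite mxE [RHS]mxE -[RHS](Kw i).
  by apply: eq_bigr => s _; rewrite [z _ _]mxE.
have : (y *m z) 0 0 = 0 by rewrite yE -mulmxA Kz mulmx0 mxE.
by rewrite mxE => yz; rewrite -[RHS]yz; apply: eq_bigr => s _; rewrite !mxE.
Qed.

End TraceCovariance.

End Moments.

(** * Block moment matrices *)

Section Vec.
Variable R : realType.

Lemma vec_dot m k (A B : 'M[R]_(m, k)) :
  \sum_s vec A s 0 * vec B s 0 = \tr (A^T *m B).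
Proof.
rewrite /mxtrace; under [RHS]eq_bigr => j _ do rewrite mxE.
rewrite pair_bigA/= (reindex _ (curry_mxvec_bij k m)).
by apply: eq_bigr => -[j i] _ /=; rewrite !mxE !mxvecE !mxE.
Qed.

Lemma vec_entry m k (s : 'I_(k * m)) :
  exists i j, forall A : 'M[R]_(m, k), vec A s 0 = A i j.
Proof.
case/mxvec_indexP: s => j i; exists i, j => A.
by rewrite !mxE mxvecE mxE.
Qed.

Lemma trace_mean n (A : nat -> 'M[R]_n) b0 b1 c0 c1 :
  (forall a, (A a)^T = A a) ->
  \tr (mean_C A b0 b1 *m mean_invC A c0 c1) =
  \sum_s ((b1 - b0)%:R^-1 * \sum_(b0 <= a < b1) vec (A a) s 0) *
    ((c1 - c0)%:R^-1 * \sum_(c0 <= b < c1) vec (invmx (A b)) s 0).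
Proof.
(* [vec_dot] produces a transpose, which the symmetry of the average absorbs. *)
move=> AT; have -> : mean_C A b0 b1 = (mean_C A b0 b1)^T.
  apply/matrixP => i j; rewrite !mxE !summxE; congr (_ * _).
  by apply: eq_bigr => a _; rewrite -{1}AT mxE.
rewrite -vec_dot; apply: eq_bigr => s _; have [i [j vE]] := vec_entry s.
rewrite !vE !mxE !summxE; congr (_ * _ * (_ * _)); apply: eq_bigr => a _;
  by rewrite vE.
Qed.

End Vec.

(** * Measurability of the matrix inverse *)

Section MeasurableMatrix.
Context d (T : measurableType d) (R : realType).

Definition measurable_mx m n (A : T -> 'M[R]_(m, n)) : Prop :=
  forall i j, measurable_fun setT (fun t => A t i j).

(** Writing 1/f as f times the power -1 of f^2 leads to real powers of a nonnegative base; where f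
    vanishes both sides are 0. *)
Lemma measurable_inv (f : T -> R) :
  measurable_fun setT f -> measurable_fun setT (fun t => (f t)^-1).
Proof.
move=> mf.
have -> : (fun t => (f t)^-1) = fun t => f t * powR (f t ^+ 2) (-1).
  apply/funext => t; rewrite powR_inv1 ?sqr_ge0//.
  have [->|ft0] := eqVneq (f t) 0; first by rewrite invr0 mul0r.
  by rewrite expr2 invfM mulrA divff// mul1r.
apply: measurable_funM => //.
apply: (measurableT_comp (measurable_powR (-1))); exact: measurable_funX.
Qed.

Lemma measurable_det n (A : T -> 'M[R]_n) : measurable_mx A ->
  measurable_fun setT (fun t => \det (A t)).
Proof.
move=> mA; apply: measurable_sum => s; apply: measurable_funM => //.
by apply: measurable_prod => i _; exact: mA.
Qed.

Lemma measurable_adjugate n (A : T -> 'M[R]_n) : measurable_mx A ->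
  measurable_mx (fun t => \adj (A t)).
Proof.
move=> mA i j.
under eq_fun do rewrite mxE /cofactor.
apply: measurable_funM => //; apply: measurable_det => k l.
by under eq_fun do rewrite !mxE; exact: mA.
Qed.

Lemma measurable_invmx n (A : T -> 'M[R]_n) : measurable_mx A ->
  measurable_mx (fun t => invmx (A t)).
Proof.
move=> mA i j.
(* [invmx] returns its argument on a singular matrix, hence the branch on the determinant; elsewhere
   Cramer's formula applies. *)
have -> : (fun t => invmx (A t) i j) = fun t =>
    if \det (A t) == 0 then A t i j else (\det (A t))^-1 * \adj (A t) i j.
  apply/funext => t; rewrite /invmx unitmxE unitfE.
  by case: eqVneq => //= _; rewrite mxE.
apply: measurable_fun_ifT.
- by apply: measurable_fun_eqr => //; exact: measurable_det.
- exact: mA.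
- apply: measurable_funM; first by apply: measurable_inv; exact: measurable_det.
  exact: measurable_adjugate.
Qed.

Lemma measurable_vec m n (A : T -> 'M[R]_(m, n)) s : measurable_mx A ->
  measurable_fun setT (fun t => vec (A t) s 0).
Proof.
move=> mA; have [i [j vE]] := vec_entry R s.
by under eq_fun do rewrite vE; exact: mA.
Qed.

End MeasurableMatrix.

Section EmpiricalMoment.
Context (R : realType) (M d : nat) (phi : 'I_d -> M.-tuple R -> R).

Lemma emp_momentE n N (x : 'I_N -> M.-tuple R) D i j :
  emp_moment phi n x D i j =
  n%:R^-1 * \sum_(l < N | D l) phi i (x l) * phi j (x l).
Proof.
rewrite mxE summxE; congr (_ * _); apply: eq_bigr => l _.
by rewrite mxE big_ord1 !mxE.
Qed.

Lemma emp_moment_sym n N (x : 'I_N -> M.-tuple R) D :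
  (emp_moment phi n x D)^T = emp_moment phi n x D.
Proof.
apply/matrixP => i j; rewrite mxE !emp_momentE; congr (_ * _).
by apply: eq_bigr => l _; rewrite mulrC.
Qed.

Lemma block_index_proof n N b (bN : (b.+1 * n <= N)%N) (i : 'I_n) :
  (b * n + i < N)%N.
Proof. by apply: leq_trans bN; rewrite mulSn addnC ltn_add2r. Qed.

Definition block_index n N b (bN : (b.+1 * n <= N)%N) (i : 'I_n) : 'I_N :=
  Ordinal (block_index_proof bN i).

Lemma block_index_inj n N b (bN : (b.+1 * n <= N)%N) :
  injective (block_index bN).
Proof. by move=> i j [] /addnI /val_inj. Qed.

(** Turns a block into a full sample of size [n], the form of the empirical matrix of D_0, so that
    their laws can be compared. *)
Lemma block_momentE n N b (bN : (b.+1 * n <= N)%N) (x : 'I_N -> M.-tuple R) :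
  (0 < n)%N ->
  block_moment phi n x b = emp_moment phi n (x \o block_index bN) xpredT.
Proof.
move=> n0; apply/matrixP => i j; rewrite !emp_momentE; congr (_ * _).
pose v (l : 'I_N) : 'I_n := Ordinal (ltn_pmod l n0).
have uv l : @block n N b l -> block_index bN (v l) = l.
  by move=> /eqP lb; apply: val_inj; rewrite /= [RHS](divn_eq l n) lb.
rewrite (reindex_onto (block_index bN) v) => [|l]; last exact: uv.
apply: eq_bigl => l; rewrite /block/= divnMDl// divn_small// addn0 eqxx/=.
by apply/eqP/val_inj; rewrite /= modnMDl modn_small.
Qed.

End EmpiricalMoment.

(** * Law of a subsample *)

Section SubsampleLaw.
Context d (T : measurableType d) d' (Omega : measurableType d') (R : realType).
Variable P : probability Omega R.

Definition subsample N k (x : 'I_N -> Omega -> T) (u : 'I_k -> 'I_N) w :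
  k.-tuple T := [tuple x (u i) w | i < k].

Lemma measurable_subsample N k (x : 'I_N -> Omega -> T) (u : 'I_k -> 'I_N) :
  (forall i, measurable_fun setT (x i)) -> measurable_fun setT (subsample x u).
Proof.
move=> mx; apply/measurable_fun_tnthP => i.
by apply: eq_measurable_fun (mx (u i)) => w _ /=; rewrite tnth_mktuple.
Qed.

Variable F : set T -> \bar R.

(** The value depends only on [F] and the box, so subsamples of equal size from two independent
    families with the same marginals agree in law. *)
Lemma subsample_box N k (x : 'I_N -> Omega -> T) (u : 'I_k -> 'I_N) A :
  injective u ->
  (forall i B, measurable B -> P (x i @^-1` B) = F B) ->
  (forall (J : {set 'I_N}) (B : 'I_N -> set T),
    (forall i, measurable (B i)) ->
    P (\bigcap_(i in [set` J]) (x i @^-1` B i)) =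
    (\prod_(i in J) P (x i @^-1` B i))%E) ->
  (forall i, measurable (A i)) ->
  P (subsample x u @^-1` box A) = (\prod_(i < k) F (A i))%E.
Proof.
move=> u_inj xF indep_x mA.
(* Carries the box along [u]; indices off its image get the trivial constraint. *)
pose A' j := if [pick i | u i == j] is Some i then A i else setT.
have A'u i : A' (u i) = A i.
  rewrite /A'; case: pickP => [i' /eqP/u_inj->//|/(_ i)].
  by rewrite eqxx.
have mA' j : measurable (A' j) by rewrite /A'; case: pickP.
have -> : subsample x u @^-1` box A =
    \bigcap_(j in [set` (u @: [set: 'I_k])%SET]) (x j @^-1` A' j).
  apply/seteqP; split => w /= h.
    move=> j /= /imsetP[i _ ->]; rewrite /preimage/= A'u.
    by have := h i; rewrite tnth_mktuple.
  move=> i; rewrite tnth_mktuple -A'u; apply: (h (u i)) => /=.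
  exact: imset_f.
rewrite indep_x// big_imset/=; last by move=> i j _ _ /u_inj.
rewrite (eq_bigl xpredT); last by move=> i; rewrite inE.
by apply: eq_bigr => i _; rewrite xF// A'u.
Qed.

End SubsampleLaw.

(** * Moments of the blocks *)

Section SameLaw.
Context d (Omega : measurableType d) (R : realType) (P : probability Omega R).

(** Second moments are expectations of measurable functions of the coordinate tuple, so the law
    determines them. [Y] stands for [muh] or [nuh], and [Z] for the vectorized matrix of an actual
    block. *)
Lemma same_law_moments k (Y Z : Omega -> 'cV[R]_k) :
  (forall s, measurable_fun setT (fun w => Z w s 0)) ->
  square_integrable P Y -> same_law P Y Z ->
  (forall s, (fun w => Z w s 0) \in Lfun P 2%:E) /\
  (forall s t, Covmx P Y s t = rE P (fun w => Z w s 0 * Z w t 0) -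
    rE P (fun w => Z w s 0) * rE P (fun w => Z w t 0)).
Proof.
move=> mZ Y2 YZ.
have mtup (W : Omega -> 'cV[R]_k) : (forall s, measurable_fun setT (fun w => W w s 0)) ->
    measurable_fun setT (fun w => [tuple W w i 0 | i < k]).
  move=> mW; apply/measurable_fun_tnthP => i.
  by apply: eq_measurable_fun (mW i) => w _ /=; rewrite tnth_mktuple.
have mY s : measurable_fun setT (fun w => Y w s 0) by exact: Lfun_measurable (Y2 s).
have tnthE (W : Omega -> 'cV[R]_k) s :
    (fun w => W w s 0) = (@tnth _ _ ^~ s) \o (fun w => [tuple W w i 0 | i < k]).
  by apply/funext => w /=; rewrite tnth_mktuple.
have tnthME (W : Omega -> 'cV[R]_k) s t : (fun w => W w s 0 * W w t 0) =
    (fun u : k.-tuple R => tnth u s * tnth u t) \o (fun w => [tuple W w i 0 | i < k]).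
  by apply/funext => w /=; rewrite !tnth_mktuple.
have mM s t : measurable_fun setT (fun u : k.-tuple R => tnth u s * tnth u t).
  by apply: measurable_funM; exact: measurable_tnth.
split=> [s|s t].
  apply: Lfun2P => //; rewrite tnthME.
  apply: (eq_law_Lfun1 (mtup _ mY) (mtup _ mZ) YZ (mM s s)).
  by rewrite -tnthME; exact: (Lfun2_mul (Y2 s) (Y2 s)).
rewrite mxE rE_covariance// tnthME (tnthE Y s) (tnthE Y t).
rewrite (eq_law_rE (mtup _ mY) (mtup _ mZ) YZ (mM s t)).
rewrite !(eq_law_rE (mtup _ mY) (mtup _ mZ) YZ (@measurable_tnth _ R k _)).
by rewrite -tnthME -!tnthE.
Qed.

End SameLaw.

Section Sample.
Context (R : realType) (M d : nat).
Variables (X : set (M.-tuple R)) (p : M.-tuple R -> R).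
Variable phi : 'I_d -> M.-tuple R -> R.
Context (dO : measure_display) (Omega : measurableType dO).
Variables (P : probability Omega R) (n N : nat).
Variables (x : 'I_n -> {RV P >-> M.-tuple R}) (x' : 'I_N -> {RV P >-> M.-tuple R}).
Hypotheses (mX : measurable X) (p_density : is_density X p).
Hypothesis mphi : forall i, measurable_fun X (phi i).
Hypotheses (x_iid : iid_sample X p x) (x'_iid : iid_sample X p x').
Hypothesis n0 : (0 < n)%N.
Hypothesis C_exists : forall i j, (lebesgue_tuple R M).-integrable X
  (fun t => (phi i t * phi j t * p t)%:E).

(** [phi] is measurable on [X] only; its extension by 0 is measurable everywhere and agrees with it
    on the samples, which all lie in [X]. *)
Definition trunc_phi i : M.-tuple R -> R := phi i \_ X.

Lemma trunc_phiE i t : X t -> trunc_phi i t = phi i t.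
Proof. by move=> Xt; rewrite /trunc_phi patchE mem_set. Qed.

Lemma measurable_trunc_phi i : measurable_fun setT (trunc_phi i).
Proof. exact/(measurable_restrictT _ mX). Qed.

Lemma emp_moment_trunc k m (y : 'I_k -> M.-tuple R) D : (forall l, X (y l)) ->
  emp_moment phi m y D = emp_moment trunc_phi m y D.
Proof.
move=> Xy; apply/matrixP => i j; rewrite !emp_momentE; congr (_ * _).
by apply: eq_bigr => l _; rewrite !trunc_phiE.
Qed.

Lemma measurable_emp_moment k m D :
  measurable_mx (fun t : k.-tuple (M.-tuple R) =>
    emp_moment trunc_phi m (fun l => tnth t l) D).
Proof.
move=> i j; under eq_fun do rewrite emp_momentE.
apply: measurable_funM => //.
have -> : (fun t : k.-tuple (M.-tuple R) => \sum_(l < k | D l)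
      trunc_phi i (tnth t l) * trunc_phi j (tnth t l)) =
    (fun t => \sum_(l < k) if D l then
      trunc_phi i (tnth t l) * trunc_phi j (tnth t l) else 0).
  by apply/funext => t; rewrite big_mkcond.
apply: measurable_sum => l; case: (D l) => //.
by apply: measurable_funM;
  exact: (measurableT_comp (measurable_trunc_phi _) (measurable_tnth l)).
Qed.

Definition sample : Omega -> N.-tuple (M.-tuple R) :=
  subsample (fun i => x' i : Omega -> M.-tuple R) id.

Definition sample_block b (t : N.-tuple (M.-tuple R)) : 'M[R]_d :=
  block_moment trunc_phi n (fun l => tnth t l) b.

Lemma block_moment_sample w b :
  block_moment phi n (fun i => x' i w) b = sample_block b (sample w).
Proof.
have [Xx' _ _] := x'_iid.
rewrite /block_moment emp_moment_trunc; last by move=> l; exact: Xx'.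
congr (emp_moment trunc_phi n _ _); apply/funext => l.
by rewrite tnth_mktuple.
Qed.

Lemma measurable_sample : measurable_fun setT sample.
Proof. exact: measurable_subsample. Qed.

Lemma measurable_sample_block b : measurable_mx (sample_block b).
Proof. exact: measurable_emp_moment. Qed.

Let t0 : M.-tuple R := [tuple 0 | _ < M].
Let smask := mask (fun i => x' i : Omega -> M.-tuple R) t0.

Definition blocks_in lo hi : {set 'I_N} := [set i : 'I_N | (lo <= i %/ n < hi)%N]%SET.

(** Dependence on few blocks is encoded as invariance under masking, so that [f] remains a function
    of the whole tuple and [indep_mask] applies. *)
Definition depends_on_blocks lo hi (f : N.-tuple (M.-tuple R) -> R) : Prop :=
  forall w, f (smask (blocks_in lo hi) w) = f (sample w).

Lemma sample_block_mask lo hi b w : (lo <= b < hi)%N ->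
  sample_block b (smask (blocks_in lo hi) w) = sample_block b (sample w).
Proof.
move=> bin; apply/matrixP => i j; rewrite !emp_momentE; congr (_ * _).
apply: eq_bigr => l; rewrite /block => /eqP lb.
by rewrite !tnth_mktuple inE lb bin.
Qed.

Lemma uncorrelated_blocks lo hi lo' hi' f g :
  (hi <= lo')%N \/ (hi' <= lo)%N ->
  measurable_fun setT f -> measurable_fun setT g ->
  depends_on_blocks lo hi f -> depends_on_blocks lo' hi' g ->
  uncorrelated P (f \o sample) (g \o sample).
Proof.
move=> lohi mf mg fJ gK f1 g1.
have [_ _ indep_x'] := x'_iid.
have mx' i : measurable_fun setT (x' i) by [].
have JK (i : 'I_N) : i \in blocks_in lo hi -> i \notin blocks_in lo' hi'.
  by rewrite !inE; lia.
have fE : f \o sample = f \o smask (blocks_in lo hi).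
  by apply/funext => w /=; rewrite fJ.
have gE : g \o sample = g \o smask (blocks_in lo' hi').
  by apply/funext => w /=; rewrite gK.
have -> : (fun w => (f \o sample) w * (g \o sample) w) = (fun w =>
    f (smask (blocks_in lo hi) w) * g (smask (blocks_in lo' hi') w)).
  by apply/funext => w /=; rewrite fJ gK.
rewrite fE gE in f1 g1 *.
apply: indep_Lfun1_rE => //; [exact: measurable_mask..|].
exact: indep_mask.
Qed.

Lemma rE_sample_block b i j : (b.+1 * n <= N)%N ->
  rE P (fun w => sample_block b (sample w) i j) = pop_moment phi X p i j.
Proof.
move=> bN; have [Xx' lawx' _] := x'_iid; have [mp p0 _] := p_density.
pose h t := trunc_phi i t * trunc_phi j t.
have mh : measurable_fun setT h by apply: measurable_funM; exact: measurable_trunc_phi.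
have hX t : X t -> h t = phi i t * phi j t by move=> Xt; rewrite /h !trunc_phiE.
have ih : (lebesgue_tuple R M).-integrable X (fun t => (h t * p t)%:E).
  apply: eq_integrable (C_exists i j) => // t; rewrite inE => Xt.
  by rewrite hX.
have Eh l : (h \o x' l) \in Lfun P 1 /\ rE P (h \o x' l) = pop_moment phi X p i j.
  have [h1 ->] := rE_density mX mp p0 (measurable_funP (x' l)) (lawx' l) mh ih.
  split=> //; rewrite mxE; apply: eq_Rintegral => t; rewrite inE => Xt.
  by rewrite hX// mxE big_ord1 !mxE.
have -> : (fun w => sample_block b (sample w) i j) =
    (fun w => n%:R^-1 * \sum_(l < n) (h \o x' (block_index bN l)) w).
  apply/funext => w; rewrite /sample_block (block_momentE _ bN)// emp_momentE.
  by congr (_ * _); apply: eq_bigr => l _; rewrite /= tnth_mktuple.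
rewrite rE_scalel; last first.
  by apply: (Lfun_sum _ (lexx 1)) => l _; case: (Eh (block_index bN l)).
rewrite rE_sum => [|l _]; last by case: (Eh (block_index bN l)).
rewrite (eq_bigr (fun=> pop_moment phi X p i j)); last first.
  by move=> l _; case: (Eh (block_index bN l)).
rewrite sumr_const card_ord -(mulr_natl (pop_moment _ _ _ _ _)) mulrA mulVf ?mul1r//.
by rewrite pnatr_eq0 -lt0n.
Qed.

(** Every block and D_0 are tuples of [n] i.i.d. draws from [p], hence equal in law. This links V,
    defined from D_0, to the blocks, and gives all blocks the same mixed moments. *)
Lemma rE_block_law (g : 'M[R]_d -> R) b : (b.+1 * n <= N)%N ->
  measurable_fun setT (fun t : n.-tuple (M.-tuple R) =>
    g (emp_moment trunc_phi n (fun l => tnth t l) xpredT)) ->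
  rE P (fun w => g (sample_block b (sample w))) =
  rE P (fun w => g (emp_moment phi n (fun i => x i w) xpredT)).
Proof.
move=> bN mg; have [Xx lawx ix] := x_iid; have [Xx' lawx' ix'] := x'_iid.
set h := (X in measurable_fun _ X) in mg.
pose xs := subsample (fun i => x i : Omega -> M.-tuple R) id.
pose xb := subsample (fun i => x' i : Omega -> M.-tuple R) (block_index bN).
have mxs : measurable_fun setT xs by exact: measurable_subsample.
have mxb : measurable_fun setT xb by exact: measurable_subsample.
have law B : measurable B -> P (xb @^-1` B) = P (xs @^-1` B).
  move=> mB; apply: tuple_law_unique => // A mA.
  rewrite (subsample_box (F := fun A => \int[lebesgue_tuple R M]_(t in A `&` X) (p t)%:E)%E)//;
    last exact: block_index_inj.
  by rewrite (subsample_box (F := fun A => \int[lebesgue_tuple R M]_(t in A `&` X) (p t)%:E)%E).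
have -> : (fun w => g (sample_block b (sample w))) = h \o xb.
  apply/funext => w; rewrite /= /h /sample_block (block_momentE _ bN)//.
  congr (g (emp_moment _ _ _ _)); apply/funext => l /=.
  by rewrite !tnth_mktuple.
have -> : (fun w => g (emp_moment phi n (fun i => x i w) xpredT)) = h \o xs.
  apply/funext => w; rewrite /= /h emp_moment_trunc; last by move=> l; exact: Xx.
  congr (g (emp_moment _ _ _ _)); apply/funext => l /=.
  by rewrite tnth_mktuple.
exact: eq_law_rE.
Qed.

Variables (muh nuh : Omega -> 'cV[R]_(d * d)) (B : nat).
Hypothesis NE : N = (B * n)%N.
Hypothesis B_gt1 : (1 < B)%N.
Hypothesis block_unit : forall b, (b < B)%N ->
  {ae P, forall w, sample_block b (sample w) \in unitmx}.
Hypothesis muh_copy : forall a, (a < B)%N ->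
  same_law P muh (fun w => vec (sample_block a (sample w))).
Hypothesis nuh_copy : forall b, (b < B)%N ->
  same_law P nuh (fun w => vec (invmx (sample_block b (sample w)))).
Hypotheses (muh_L2 : square_integrable P muh) (nuh_L2 : square_integrable P nuh).

Let C := pop_moment phi X p.
Let V := Emx P (fun w => invmx (emp_moment phi n (fun i => x i w) xpredT)).
Let mu s := vec C s 0.
Let nu s := vec V s 0.
Let muf s b (t : N.-tuple (M.-tuple R)) := vec (sample_block b t) s 0.
Let nuf s b (t : N.-tuple (M.-tuple R)) := vec (invmx (sample_block b t)) s 0.
Let muw s b w := muf s b (sample w).
Let nuw s b w := nuf s b (sample w).

Let blockN b : (b < B)%N -> (b.+1 * n <= N)%N.
Proof. by move=> bB; rewrite NE leq_mul2r bB orbT. Qed.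

Let mmuf s b : measurable_fun setT (muf s b).
Proof. by apply: measurable_vec; exact: measurable_sample_block. Qed.

Let mnuf s b : measurable_fun setT (nuf s b).
Proof.
by apply: measurable_vec; apply: measurable_invmx; exact: measurable_sample_block.
Qed.

Let muf_depends s lo hi b : (lo <= b < hi)%N -> depends_on_blocks lo hi (muf s b).
Proof. by move=> bin w; rewrite /muf sample_block_mask. Qed.

Let nuf_depends s lo hi b : (lo <= b < hi)%N -> depends_on_blocks lo hi (nuf s b).
Proof. by move=> bin w; rewrite /nuf sample_block_mask. Qed.

Let avg_depends (F : nat -> N.-tuple (M.-tuple R) -> R) lo hi :
  (forall b, (lo <= b < hi)%N -> depends_on_blocks lo hi (F b)) ->
  depends_on_blocks lo hi (avg F lo hi).
Proof.
by move=> FJ w; congr (_ * _); apply: eq_big_nat => b bin; exact: FJ.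
Qed.

Let mavg (F : nat -> N.-tuple (M.-tuple R) -> R) lo hi :
  (forall b, measurable_fun setT (F b)) -> measurable_fun setT (avg F lo hi).
Proof. by move=> mF; apply: measurable_funM => //; exact: measurable_sum. Qed.

Let mu_moments b : (b < B)%N ->
  [/\ forall s, muw s b \in Lfun P 2%:E, forall s, rE P (muw s b) = mu s &
   forall s t, rE P (fun w => muw s b w * muw t b w) =
     Covmx P muh s t + mu s * mu t].
Proof.
move=> bB; have mZ s : measurable_fun setT (fun w => vec (sample_block b (sample w)) s 0).
  exact: (measurableT_comp (mmuf s b) measurable_sample).
have [L2 cov] := same_law_moments mZ muh_L2 (muh_copy bB).
have E1 s : rE P (muw s b) = mu s.
  have [i [j vE]] := vec_entry R s.
  rewrite /mu vE -(rE_sample_block i j (blockN bB)); congr rE.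
  by apply/funext => w; rewrite /muw /muf vE.
by split => // s t; rewrite cov !E1 subrK.
Qed.

Let nu_moments b : (b < B)%N ->
  [/\ forall s, nuw s b \in Lfun P 2%:E, forall s, rE P (nuw s b) = nu s &
   forall s t, rE P (fun w => nuw s b w * nuw t b w) =
     Covmx P nuh s t + nu s * nu t].
Proof.
move=> bB; have mZ s : measurable_fun setT
    (fun w => vec (invmx (sample_block b (sample w))) s 0).
  exact: (measurableT_comp (mnuf s b) measurable_sample).
have [L2 cov] := same_law_moments mZ nuh_L2 (nuh_copy bB).
have E1 s : rE P (nuw s b) = nu s.
  have [i [j vE]] := vec_entry R s.
  rewrite /nu vE mxE -/(rE P _).
  rewrite -(rE_block_law (g := fun A => invmx A i j) (blockN bB)).
    by congr rE; apply/funext => w; rewrite /nuw /nuf vE.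
  by apply: measurable_invmx; exact: measurable_emp_moment.
by split => // s t; rewrite cov !E1 subrK.
Qed.

(** Supplies the dichotomy required by [rE_avg_mul], for the pairs (mu, nu), (mu, mu) and (nu, nu)
    alike. *)
Let pair_moments (f g : nat -> N.-tuple (M.-tuple R) -> R) e1 e2 q :
  (forall b, measurable_fun setT (f b)) -> (forall b, measurable_fun setT (g b)) ->
  (forall b, depends_on_blocks b b.+1 (f b)) ->
  (forall b, depends_on_blocks b b.+1 (g b)) ->
  (forall b, (b < B)%N -> f b \o sample \in Lfun P 2%:E) ->
  (forall b, (b < B)%N -> g b \o sample \in Lfun P 2%:E) ->
  (forall b, (b < B)%N -> rE P (f b \o sample) = e1) ->
  (forall b, (b < B)%N -> rE P (g b \o sample) = e2) ->
  (forall b, (b < B)%N -> rE P (fun w => f b (sample w) * g b (sample w)) = q) ->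
  forall a b, (a < B)%N -> (b < B)%N ->
    (fun w => f a (sample w) * g b (sample w)) \in Lfun P 1 /\
    rE P (fun w => f a (sample w) * g b (sample w)) = if a == b then q else e1 * e2.
Proof.
move=> mf mg fJ gJ f2 g2 Ef Eg Eq a b aB bB.
split; first by apply: Lfun2_mul; [exact: f2|exact: g2].
case: eqVneq => [<-|ab]; first exact: Eq.
have sep : (a.+1 <= b)%N \/ (b.+1 <= a)%N by lia.
have [_] := uncorrelated_blocks sep (mf a) (mg b) (fJ a) (gJ b)
  (Lfun2_Lfun1 (f2 a aB)) (Lfun2_Lfun1 (g2 b bB)).
by rewrite Ef// Eg.
Qed.

Let trace_CV : \tr (C *m V) = \sum_s mu s * nu s.
Proof.
rewrite vec_dot; congr (\tr (_ *m _)); apply/matrixP => i j.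
rewrite !mxE; apply: eq_Rintegral => t _.
by rewrite !mxE !big_ord1 !mxE (mulrC (phi i t)).
Qed.

Let blocks w b := sample_block b (sample w).

Let trace_meanE b0 b1 c0 c1 :
  (fun w => \tr (mean_C (blocks w) b0 b1 *m mean_invC (blocks w) c0 c1)) =
  (fun w => \sum_s avg (muw s) b0 b1 w * avg (nuw s) c0 c1 w).
Proof.
by apply/funext => w; rewrite trace_mean// => a; exact: emp_moment_sym.
Qed.

Let vec_dot_inv b : (b < B)%N ->
  {ae P, forall w, \sum_s muw s b w * nuw s b w = d%:R}.
Proof.
move=> bB; apply: filterS (block_unit bB) => w Aunit.
by rewrite vec_dot emp_moment_sym mulmxV// mxtrace1.
Qed.

(** [b1 = B1] serves H2 and [b1 = B] serves H3. *)
Lemma bias_overlap b1 : (0 < b1 <= B)%N ->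
  bias P (fun w => mean_C (blocks w) 0 b1 *m mean_invC (blocks w) 0 B)
    (C *m V) = ((d%:R - \tr (C *m V)) / B%:R)%:E.
Proof.
move=> /andP[b1_gt0 b1B]; have B0 : (0 < B)%N by exact: ltnW.
(* The mixed moments [q s] are not computed individually: they are common to all blocks, and their
   sum is the mean trace of C_b C_b^-1. *)
pose q s := rE P (fun w => muw s 0%N w * nuw s 0%N w).
have qE s b : (b < B)%N -> rE P (fun w => muw s b w * nuw s b w) = q s.
  have mg : measurable_fun setT (fun t : n.-tuple (M.-tuple R) =>
      let A := emp_moment trunc_phi n (fun l => tnth t l) xpredT in
      vec A s 0 * vec (invmx A) s 0).
    apply: measurable_funM; apply: measurable_vec; last apply: measurable_invmx;
      exact: measurable_emp_moment.
  by move=> bB; rewrite /q !(rE_block_law (g := fun A => vec A s 0 * vec (invmx A) s 0) (blockN _) mg).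
have sum_q : \sum_s q s = d%:R.
  rewrite -rE_sum => [|s _]; last first.
    have [mu2 _ _] := mu_moments B0; have [nu2 _ _] := nu_moments B0.
    exact: (Lfun2_mul (mu2 s) (nu2 s)).
  rewrite -[RHS](rE_cst P); apply: ae_eq_rE => //; last exact: vec_dot_inv.
  apply: measurable_sum => s; apply: measurable_funM.
    exact: (measurableT_comp (mmuf s 0%N) measurable_sample).
  exact: (measurableT_comp (mnuf s 0%N) measurable_sample).
have avgE s : (fun w => avg (muw s) 0 b1 w * avg (nuw s) 0 B w) \in Lfun P 1 /\
    rE P (fun w => avg (muw s) 0 b1 w * avg (nuw s) 0 B w) =
    mu s * nu s + (q s - mu s * nu s) / B%:R.
  rewrite -[in X in _ / X](subn0 B); apply: rE_avg_mul => // a b /andP[_ aB] /andP[_ bB].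
  apply: (pair_moments (f := muf s) (g := nuf s)) => //.
  - by move=> c; apply: muf_depends; rewrite leqnn/=.
  - by move=> c; apply: nuf_depends; rewrite leqnn/=.
  - by move=> c cB; have [L2 _ _] := mu_moments cB; exact: L2.
  - by move=> c cB; have [L2 _ _] := nu_moments cB; exact: L2.
  - by move=> c cB; have [_ E1 _] := mu_moments cB; exact: E1.
  - by move=> c cB; have [_ E1 _] := nu_moments cB; exact: E1.
  - by move=> c cB; exact: qE.
have L1 : (fun w => \sum_s avg (muw s) 0 b1 w * avg (nuw s) 0 B w) \in Lfun P 1.
  by apply: (Lfun_sum _ (lexx 1)) => s _; case: (avgE s).
rewrite /bias -(trace_meanE 0 b1 0 B) in L1 *.
rewrite rEK; last by rewrite rpredB// Lfun_cst.
rewrite rE_sub// ?Lfun_cst// rE_cst trace_meanE rE_sum => [|s _]; last by case: (avgE s).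
rewrite (eq_bigr (fun s => mu s * nu s + (q s - mu s * nu s) / B%:R)); last first.
  by move=> s _; case: (avgE s).
by rewrite big_split/= -mulr_suml sumrB sum_q -trace_CV addrAC subrr add0r.
Qed.

(** Distinct blocks are independent, so averaging divides the covariance by the number of blocks;
    this is [rE_avg_mul] with two equal ranges. *)
Let avg_moments k : (0 < k < B)%N ->
  [/\ forall s, avg (muw s) 0 k \in Lfun P 2%:E,
      forall s, avg (nuw s) k B \in Lfun P 2%:E,
      forall s, rE P (avg (muw s) 0 k) = mu s,
      forall s, rE P (avg (nuw s) k B) = nu s &
   [/\ forall s t, rE P (fun w => avg (muw s) 0 k w * avg (muw t) 0 k w) =
         mu s * mu t + Covmx P muh s t / k%:R &
       forall s t, rE P (fun w => avg (nuw s) k B w * avg (nuw t) k B w) =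
         nu s * nu t + Covmx P nuh s t / (B - k)%:R]].
Proof.
move=> /andP[k0 kB].
have ltB a : (0 <= a < k)%N -> (a < B)%N by move=> /andP[_ /ltn_trans]; apply.
have geB a : (k <= a < B)%N -> (a < B)%N by case/andP.
have mu2 s a (aB : (a < B)%N) : muw s a \in Lfun P 2%:E.
  by have [+ _ _] := mu_moments aB; exact.
have nu2 s a (aB : (a < B)%N) : nuw s a \in Lfun P 2%:E.
  by have [+ _ _] := nu_moments aB; exact.
have Emu s a (aB : (a < B)%N) : rE P (muw s a) = mu s.
  by have [_ + _] := mu_moments aB; exact.
have Enu s a (aB : (a < B)%N) : rE P (nuw s a) = nu s.
  by have [_ + _] := nu_moments aB; exact.
split.
- by move=> s; apply: avg_Lfun => [|a /ltB]; [exact: ler1n|exact: mu2].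
- by move=> s; apply: avg_Lfun => [|a /geB]; [exact: ler1n|exact: nu2].
- move=> s; apply: rE_avg => // a /ltB aB; last exact: Emu.
  by apply: Lfun2_Lfun1; exact: mu2.
- move=> s; apply: rE_avg => // a /geB aB; last exact: Enu.
  by apply: Lfun2_Lfun1; exact: nu2.
split=> s t.
  have [|_ ->] := @rE_avg_mul _ _ _ P (muw s) (muw t) 0 k 0 k (mu s * mu t)
      (Covmx P muh s t + mu s * mu t) k0 (leqnn _) (leqnn _).
    move=> a b /ltB aB /ltB bB.
    apply: (pair_moments (f := muf s) (g := muf t)) => //.
    + by move=> c; apply: muf_depends; rewrite leqnn/=.
    + by move=> c; apply: muf_depends; rewrite leqnn/=.
    + exact: mu2.
    + exact: mu2.
    + exact: Emu.
    + exact: Emu.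
    + by move=> c cB; have [_ _ +] := mu_moments cB; exact.
  by rewrite addrK subn0.
have [|_ ->] := @rE_avg_mul _ _ _ P (nuw s) (nuw t) k B k B (nu s * nu t)
    (Covmx P nuh s t + nu s * nu t) kB (leqnn _) (leqnn _).
  move=> a b /geB aB /geB bB.
  apply: (pair_moments (f := nuf s) (g := nuf t)) => //.
  + by move=> c; apply: nuf_depends; rewrite leqnn/=.
  + by move=> c; apply: nuf_depends; rewrite leqnn/=.
  + exact: nu2.
  + exact: nu2.
  + exact: Enu.
  + exact: Enu.
  + by move=> c cB; have [_ _ +] := nu_moments cB; exact.
by rewrite addrK.
Qed.

Let uncorrelated_avg k : (0 < k < B)%N ->
  (forall s, uncorrelated P (avg (muw s) 0 k) (avg (nuw s) k B)) /\
  (forall s t, uncorrelated P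
    (fun w => avg (muw s) 0 k w * avg (muw t) 0 k w)
    (fun w => avg (nuw s) k B w * avg (nuw t) k B w)).
Proof.
move=> /andP[k0 kB]; have sep : (k <= k)%N \/ (B <= 0)%N by left.
have mm s : measurable_fun setT (avg (muf s) 0 k) by exact: mavg.
have mn s : measurable_fun setT (avg (nuf s) k B) by exact: mavg.
have dm s : depends_on_blocks 0 k (avg (muf s) 0 k).
  by apply: avg_depends => b; exact: muf_depends.
have dn s : depends_on_blocks k B (avg (nuf s) k B).
  by apply: avg_depends => b; exact: nuf_depends.
split=> [s|s t]; first exact: (uncorrelated_blocks sep (mm s) (mn s) (dm s) (dn s)).
apply: (uncorrelated_blocks sep
  (f := fun z => avg (muf s) 0 k z * avg (muf t) 0 k z)
  (g := fun z => avg (nuf s) k B z * avg (nuf t) k B z)).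
- exact: measurable_funM.
- exact: measurable_funM.
- by move=> w; rewrite !dm.
- by move=> w; rewrite !dn.
Qed.

(** * Bias and variance of the first estimator, and its degenerate case *)

Let Smunu := \tr (Covmx P muh *m Covmx P nuh).
Let vecV : 'cV[R]_(d * d) := vec V.
Let vecC : 'cV[R]_(d * d) := vec C.
Let Smu := \tr (Covmx P muh *m (vecV *m vecV^T)).
Let Snu := \tr (Covmx P nuh *m (vecC *m vecC^T)).

Let Covmx_sym (Y : Omega -> 'cV[R]_(d * d)) s t : Covmx P Y s t = Covmx P Y t s.
Proof. by rewrite !mxE covarianceC. Qed.

Let SmunuE : Smunu = \sum_s \sum_t Covmx P muh s t * Covmx P nuh s t.
Proof.
apply: eq_bigr => s _; rewrite mxE; apply: eq_bigr => t _.
by rewrite [Covmx P nuh t s]Covmx_sym.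
Qed.

Let SmuE : Smu = \sum_s \sum_t nu s * nu t * Covmx P muh s t.
Proof.
apply: eq_bigr => s _; rewrite mxE; apply: eq_bigr => t _.
by rewrite [(vecV *m _) _ _]mxE big_ord1 [vecV^T _ _]mxE mulrC (mulrC (nu s)).
Qed.

Let SnuE : Snu = \sum_s \sum_t mu s * mu t * Covmx P nuh s t.
Proof.
apply: eq_bigr => s _; rewrite mxE; apply: eq_bigr => t _.
by rewrite [(vecC *m _) _ _]mxE big_ord1 [vecC^T _ _]mxE mulrC (mulrC (mu s)).
Qed.

Lemma bias_split k : (0 < k < B)%N ->
  bias P (fun w => mean_C (blocks w) 0 k *m mean_invC (blocks w) k B)
    (C *m V) = 0%E.
Proof.
move=> kB; have [m2 v2 Em Ev [Emm Evv]] := avg_moments kB.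
have [um umm] := uncorrelated_avg kB.
have [f2 Ef _] := variance_dot m2 v2 um umm.
have L1 := Lfun2_Lfun1 f2.
rewrite /bias -(trace_meanE 0 k k B) in L1 Ef *.
rewrite rEK; last by rewrite rpredB// Lfun_cst.
rewrite rE_sub// ?Lfun_cst// rE_cst Ef trace_CV.
by rewrite (eq_bigr (fun s => mu s * nu s)) ?subrr// => s _; rewrite Em Ev.
Qed.

(** Each pair (s, t) contributes (mu_s mu_t + M_st / k) (nu_s nu_t + N_st / (B - k)) - mu_s mu_t
    nu_s nu_t, with M and N the two covariances; the three surviving products give the three
    terms. *)
Lemma variance_split k : (0 < k < B)%N ->
  ('V_P[fun w => \tr (mean_C (blocks w) 0 k *m mean_invC (blocks w) k B)] =
   (Smunu / (k%:R * (B - k)%:R) + Snu / (B - k)%:R + Smu / k%:R)%:E)%E.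
Proof.
move=> kB; have [m2 v2 Em Ev [Emm Evv]] := avg_moments kB.
have [um umm] := uncorrelated_avg kB.
have [_ _] := variance_dot m2 v2 um umm; rewrite -trace_meanE => ->.
congr EFin; rewrite expr2 big_distrlr/= SmunuE SmuE SnuE.
rewrite !mulr_suml -!big_split/= -sumrB; apply: eq_bigr => s _.
rewrite !mulr_suml -!big_split/= -sumrB; apply: eq_bigr => t _.
by rewrite Emm Evv !Em !Ev invfM; ring.
Qed.

(** Both vectors come from block 0: the laws of [muh] and [nuh] say nothing about their joint law,
    and the trace identity couples a matrix with its own inverse. *)
Let Yc s w := muw s 0%N w - mu s.
Let Zc s w := nuw s 0%N w - nu s.

Let centered_moments : [/\ forall s, Yc s \in Lfun P 2%:E,
  forall s, Zc s \in Lfun P 2%:E,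
  forall s t, rE P (fun w => Yc s w * Yc t w) = Covmx P muh s t,
  forall s t, rE P (fun w => Zc s w * Zc t w) = Covmx P nuh s t &
  (forall s, rE P (Yc s) = 0) /\ (forall s, rE P (Zc s) = 0)].
Proof.
have B0 : (0 < B)%N by exact: ltnW.
have [mu2 Emu Emm] := mu_moments B0; have [nu2 Enu Enn] := nu_moments B0.
have center2 (f : Omega -> R) c : f \in Lfun P 2%:E -> (fun w => f w - c) \in Lfun P 2%:E.
  by move=> f2; apply: Lfun_add => //; [exact: ler1n|exact: Lfun_cst].
have center (f g : Omega -> R) a b : f \in Lfun P 2%:E -> g \in Lfun P 2%:E ->
    rE P f = a -> rE P g = b ->
    rE P (fun w => (f w - a) * (g w - b)) = rE P (fun w => f w * g w) - a * b.
  move=> f2 g2 Ef Eg; have f1 := Lfun2_Lfun1 f2; have g1 := Lfun2_Lfun1 g2.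
  have := rE_covariance f2 g2; rewrite unlock.
  rewrite -[fine 'E_P[f]]/(rE P f) -[fine 'E_P[g]]/(rE P g) Ef Eg => h.
  exact: (congr1 fine h).
split.
- by move=> s; exact: center2.
- by move=> s; exact: center2.
- by move=> s t; rewrite center// Emm addrK.
- by move=> s t; rewrite center// Enn addrK.
split=> s; rewrite rE_sub ?Lfun_cst// ?rE_cst ?Emu ?Enu ?subrr//; exact: Lfun2_Lfun1.
Qed.

Lemma Smunu_ge0 : 0 <= Smunu.
Proof.
have [Y2 Z2 EY EZ _] := centered_moments.
rewrite SmunuE; have := trace_cov_ge0 Y2 Z2.
by under eq_bigr do under eq_bigr do rewrite EY EZ.
Qed.

Lemma Smu_sqrE : Smu = rE P (fun w => (\sum_s nu s * Yc s w) ^+ 2).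
Proof.
have [Y2 Z2 EY EZ _] := centered_moments; rewrite -quad_covE// SmuE.
by under [RHS]eq_bigr do under eq_bigr do rewrite EY.
Qed.

Lemma Snu_sqrE : Snu = rE P (fun w => (\sum_s mu s * Zc s w) ^+ 2).
Proof.
have [Y2 Z2 EY EZ _] := centered_moments; rewrite -quad_covE// SnuE.
by under [RHS]eq_bigr do under eq_bigr do rewrite EZ.
Qed.

Lemma Smu_ge0 : 0 <= Smu.
Proof. by rewrite Smu_sqrE; apply: rE_ge0 => w; exact: sqr_ge0. Qed.

Lemma Snu_ge0 : 0 <= Snu.
Proof. by rewrite Snu_sqrE; apply: rE_ge0 => w; exact: sqr_ge0. Qed.

(* When Smunu = 0 the centered vectors are a.s. orthogonal within a block; as
   Tr (C_b C_b^-1) = d, expanding their product shows that nu . mu_b and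
   - mu . nu_b differ by a constant. *)
Lemma Smunu_eq0 : Smunu = 0 -> Smu = Snu.
Proof.
have [Y2 Z2 EY EZ [EY0 EZ0]] := centered_moments => S0.
have YZ0 : {ae P, forall w, \sum_s Yc s w * Zc s w = 0}.
  apply: trace_cov_eq0 => //; rewrite -[RHS]S0 SmunuE.
  by apply: eq_bigr => s _; apply: eq_bigr => t _; rewrite EY EZ.
pose f w := \sum_s nu s * Yc s w; pose g w := \sum_s mu s * Zc s w.
have f2 : f \in Lfun P 2%:E.
  by apply: Lfun_sum => [|s _]; [exact: ler1n|apply: Lfun_scalel => //; exact: ler1n].
have g2 : g \in Lfun P 2%:E.
  by apply: Lfun_sum => [|s _]; [exact: ler1n|apply: Lfun_scalel => //; exact: ler1n].
have f1 := Lfun2_Lfun1 f2; have g1 := Lfun2_Lfun1 g2.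
pose c := d%:R - \sum_s mu s * nu s.
have fg : {ae P, forall w, f w + g w = c}.
  apply: filterS2 YZ0 (vec_dot_inv (ltnW B_gt1)) => w YZ dE.
  have -> : f w + g w = c - \sum_s Yc s w * Zc s w.
    rewrite /c -dE /f /g -big_split -!sumrB/=.
    by apply: eq_bigr => s _; rewrite /Yc /Zc; ring.
  by rewrite YZ subr0.
(* [f] and [g] are centered, so the constant they sum to is 0. *)
have c0 : c = 0.
  rewrite -(rE_cst P c) -(ae_eq_rE _ _ fg)//; last first.
    by apply: measurable_funD; [exact: Lfun_measurable f1|exact: Lfun_measurable g1].
  rewrite rE_add// !rE_sum => [|s _|s _]; last 2 first.
    by apply: Lfun_scalel => //; exact: Lfun2_Lfun1.
    by apply: Lfun_scalel => //; exact: Lfun2_Lfun1.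
  rewrite !big1 ?addr0// => s _; rewrite rE_scalel ?EY0 ?EZ0 ?mulr0//;
    exact: Lfun2_Lfun1.
rewrite Smu_sqrE Snu_sqrE; apply: ae_eq_rE.
- by apply: measurable_funX; exact: Lfun_measurable f1.
- by apply: measurable_funX; exact: Lfun_measurable g1.
apply: filterS fg => w; rewrite c0 => /eqP; rewrite addr_eq0 => /eqP fE.
by rewrite -/(f w) -/(g w) fE sqrrN.
Qed.

End Sample.

Theorem theorem5 (R : realType) (M d : nat)
    (X : set (M.-tuple R)) (p : M.-tuple R -> R)
    (phi : 'I_d -> M.-tuple R -> R)
    (dO : measure_display) (Omega : measurableType dO)
    (P : probability Omega R)
    (n n1 n2 n' : nat)
    (x : 'I_n -> {RV P >-> M.-tuple R})
    (x' : 'I_n' -> {RV P >-> M.-tuple R})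
    (muh nuh : Omega -> 'cV[R]_(d * d)) :
  let Chat w := emp_moment phi n (fun i => x i w) xpredT in
  let C := pop_moment phi X p in
  let V := Emx P (fun w => invmx (Chat w)) in
  let Cb w b := block_moment phi n (fun i => x' i w) b in
  let B1 := (n1 %/ n)%N in
  let B2 := (n2 %/ n)%N in
  let B := (n' %/ n)%N in
  let H1 k w := Hhat1 (Cb w) k B in
  let H2 w := Hhat2 (Cb w) B1 B in
  let H3 w := Hhat3 (Cb w) B in
  let mu := vec C in
  let nu := vec V in
  let Smunu := \tr (Covmx P muh *m Covmx P nuh) in
  let Smu := \tr (Covmx P muh *m (nu *m nu^T)) in
  let Snu := \tr (Covmx P nuh *m (mu *m mu^T)) in
  let a1 := Smunu / B%:R + Smu in
  let a2 := Smunu / B%:R + Snu in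
  let Bstar := if a1 != a2
    then (a1 - Num.sqrt (a1 * a2)) / (a1 - a2) * B%:R
    else B%:R / 2 in
  forall (Xmeas : measurable X)
    (p_density : is_density X p)
    (phi_meas : forall i, measurable_fun X (phi i))
    (x_iid : iid_sample X p x)
    (x'_iid : iid_sample X p x')
    (n_gt0 : (0 < n)%N) (n1_gt0 : (0 < n1)%N) (n2_gt0 : (0 < n2)%N)
    (n_dvd_n1 : (n %| n1)%N) (n_dvd_n2 : (n %| n2)%N)
    (n'E : (n1 + n2 = n')%N)
    (Cb_unit : forall b, (b < B)%N -> {ae P, forall w, Cb w b \in unitmx})
    (muh_copy : forall a, (a < B)%N ->
      same_law P muh (fun w => vec (Cb w a)))
    (nuh_copy : forall b, (b < B)%N ->
      same_law P nuh (fun w => vec (invmx (Cb w b))))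
    (C_exists : forall i j, (lebesgue_tuple R M).-integrable X
      (fun t => (phi i t * phi j t * p t)%:E))
    (muh_L2 : square_integrable P muh)
    (nuh_L2 : square_integrable P nuh),
  [/\ bias P (H1 B1) (C *m V) = 0%E,
      bias P H2 (C *m V) = ((d%:R - \tr (C *m V)) / B%:R)%:E,
      bias P H3 (C *m V) = ((d%:R - \tr (C *m V)) / B%:R)%:E,
      'V_P[fun w => \tr (H1 B1 w)] =
        (Smunu / (B1%:R * B2%:R) + Snu / B2%:R + Smu / B1%:R)%:E &
      exists k : nat,
        [/\ k%:Z = Num.floor Bstar \/ k%:Z = Num.ceil Bstar,
            (0 < k < B)%N &
            forall m : nat, (0 < m < B)%N ->
              ('V_P[fun w => \tr (H1 k w)] <= 'V_P[fun w => \tr (H1 m w)])%E]].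
Proof.
move=> Chat C V Cb B1 B2 B H1 H2 H3 mu nu Smunu Smu Snu a1 a2 Bstar.
move=> Xmeas p_density phi_meas x_iid x'_iid n_gt0 n1_gt0 n2_gt0 n_dvd_n1 n_dvd_n2.
move=> n'E Cb_unit muh_copy nuh_copy C_exists muh_L2 nuh_L2.
have B1_gt0 : (0 < B1)%N by rewrite divn_gt0// dvdn_leq.
have B2_gt0 : (0 < B2)%N by rewrite divn_gt0// dvdn_leq.
have B1_leB : (0 < B1 <= B)%N by rewrite B1_gt0 leq_div2r// -n'E leq_addr.
have BE : B = (B1 + B2)%N by rewrite /B -n'E divnDl.
have NE : n' = (B * n)%N by rewrite BE mulnDl !divnK.
have B_gt1 : (1 < B)%N by rewrite BE -(addn1 1%N) leq_add.
have B1_split : (0 < B1 < B)%N by rewrite B1_gt0 BE -[ltnLHS]addn0 ltn_add2l.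
(* Blocks as functions of the whole tuple, with [phi] cut off outside [X]: the form in which they
   are measurable. *)
pose A w b := sample_block X phi n b (sample x' w).
have CbE : Cb = A.
  apply/funext => w; apply/funext => b.
  exact: block_moment_sample x'_iid w b.
have A_unit b : (b < B)%N -> {ae P, forall w, A w b \in unitmx}.
  by rewrite -CbE; exact: Cb_unit.
have muh_A a : (a < B)%N -> same_law P muh (fun w => vec (A w a)).
  by rewrite -CbE; exact: muh_copy.
have nuh_A b : (b < B)%N -> same_law P nuh (fun w => vec (invmx (A w b))).
  by rewrite -CbE; exact: nuh_copy.
have varE k : (0 < k < B)%N -> ('V_P[fun w => \tr (H1 k w)] =
    (Smunu / (k%:R * (B - k)%:R) + Snu / (B - k)%:R + Smu / k%:R)%:E)%E.
  by rewrite /H1 CbE; exact: (variance_split Xmeas p_density phi_meas x_iid x'_iid).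
(* Since 1 / (k (B - k)) = (1 / k + 1 / (B - k)) / B, the cross term splits evenly between the two
   weights; this is the origin of [Smunu / B%:R] in [a1] and [a2]. *)
have costE k : (0 < k < B)%N ->
    ('V_P[fun w => \tr (H1 k w)] = (split_cost a1 a2 B%:R k%:R)%:E)%E.
  move=> kB; rewrite varE//; congr EFin; case/andP: kB => k0 kB.
  rewrite /split_cost /a1 /a2 natrB ?(ltnW kB)//.
  have kR : k%:R != 0 :> R by rewrite pnatr_eq0 -lt0n.
  have BR : B%:R != 0 :> R by rewrite pnatr_eq0 -lt0n ltnW.
  have BkR : B%:R - k%:R != 0 :> R by rewrite subr_eq0 eqr_nat gtn_eqF.
  by field; rewrite kR BR BkR.
have S0 : 0 <= Smunu.
  exact: (Smunu_ge0 Xmeas p_density phi_meas x_iid x'_iid n_gt0 C_exists NE B_gt1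
    muh_A nuh_A muh_L2 nuh_L2).
have Smu0 : 0 <= Smu.
  exact: (Smu_ge0 Xmeas p_density phi_meas x_iid x'_iid n_gt0 C_exists NE B_gt1
    muh_A nuh_A muh_L2 nuh_L2).
have Snu0 : 0 <= Snu.
  exact: (Snu_ge0 Xmeas p_density phi_meas x_iid x'_iid n_gt0 C_exists NE B_gt1
    muh_A nuh_A muh_L2 nuh_L2).
have Seq0 : Smunu = 0 -> Smu = Snu.
  exact: (Smunu_eq0 Xmeas p_density phi_meas x_iid x'_iid n_gt0 C_exists NE B_gt1
    A_unit muh_A nuh_A muh_L2 nuh_L2).
have BR0 : 0 < B%:R :> R by rewrite ltr0n ltnW.
have SB0 : 0 <= Smunu / B%:R by rewrite divr_ge0// ltW.
have a10 : 0 <= a1 by rewrite addr_ge0.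
have a20 : 0 <= a2 by rewrite addr_ge0.
have a12 : a1 = a2 \/ (0 < a1 /\ 0 < a2).
  have [S_eq0|S_neq0] := eqVneq Smunu 0; first by left; rewrite /a1 Seq0.
  have SB_gt0 : 0 < Smunu / B%:R by rewrite divr_gt0// lt_def S_neq0.
  by right; split; rewrite ltr_pwDl.
have [t0 tB crit] := critical_splitP a10 a20 BR0 a12 (erefl Bstar).
have [k [kE kB kmin]] := split_cost_argmin a10 a20 B_gt1 t0 tB crit.
have B_B1 : (B - B1)%N = B2 by rewrite BE addKn.
split.
- rewrite /H1 CbE.
  exact: (bias_split Xmeas p_density phi_meas x_iid x'_iid n_gt0 C_exists NE
    B_gt1 muh_A nuh_A muh_L2 nuh_L2).
- rewrite /H2 CbE.
  exact: (bias_overlap Xmeas p_density phi_meas x_iid x'_iid n_gt0 C_exists NE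
    B_gt1 A_unit muh_A nuh_A muh_L2 nuh_L2 B1_leB).
- rewrite /H3 CbE.
  apply: (bias_overlap Xmeas p_density phi_meas x_iid x'_iid n_gt0 C_exists NE
    B_gt1 A_unit muh_A nuh_A muh_L2 nuh_L2).
  by rewrite leqnn ltnW.
- by rewrite varE// B_B1.
- exists k; split => // m mB; rewrite !costE// lee_fin; exact: kmin.
Qed.
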